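(* Let $H$ be a finite simple graph. Then there are finite sets of pathographs $\mathfrak{S}_i(H)$, $i\in\{1,2,3,4,5,6\}$, such that for every graph $G$: (1) $G$ contains $H$ as a subgraph if and only if $G$ contains some $\mathfrak{H}\in\mathfrak{S}_1(H)$; (2) $G$ contains $H$ as an induced subgraph if and only if $G$ contains some $\mathfrak{H}\in\mathfrak{S}_2(H)$; (3) $G$ contains $H$ as a minor if and only if $G$ contains some $\mathfrak{H}\in\mathfrak{S}_3(H)$; (4) $G$ contains $H$ as an induced minor if and only if $G$ contains some $\mathfrak{H}\in\mathfrak{S}_4(H)$; (5) $G$ contains $H$ as a topological minor if and only if $G$ contains some $\mathfrak{H}\in\mathfrak{S}_5(H)$; (6) $G$ contains $H$ as an induced topological minor if and only if $G$ contains some $\mathfrak{H}\in\mathfrak{S}_6(H)$. Additionally, there are finite sets of pathographs $\Theta$, $\mathrm{Py}$, $\mathrm{Pr}$, $\mathrm{W}$ such that for every graph $G$: (7) $G$ contains an induced theta if and only if $G$ contains some $\mathfrak{H}\in\Theta$; (8) $G$ contains an induced pyramid if and only if $G$ contains some $\mathfrak{H}\in\mathrm{Py}$; (9) $G$ contains an induced prism if and only if $G$ contains some $\mathfrak{H}\in\mathrm{Pr}$; (10) $G$ contains an induced wheel if and only if $G$ contains some $\mathfrak{H}\in\mathrm{W}$.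
   Context: All graphs are finite and simple. A pathograph is a tuple $\mathfrak{G}=(V,U,E,S,R,\pi)$ where $V$ (vertices) and $U$ (urpaths) are finite disjoint sets, $E\subseteq\binom{V}{2}$ (edges), $S\subseteq V\times U$ (spokes), $R\subseteq\binom{U}{2}$ (rungs), and $\pi:U\to\binom{V}{2}$ assigns to each urpath its two distinct endpoints, with $\pi(U)\cap E=\emptyset$. A graph is regarded as a pathograph with no urpaths, spokes or rungs. A realization of $\mathfrak{G}$ is a graph obtained as follows: start from the graph $(V,E)$; for each urpath $u$ with endpoints $a,b$ add new vertices $x_u^{(1)},\dots,x_u^{(m_u)}$ ($m_u\ge 1$, the internal vertices of $u$) and the edges of the path $a x_u^{(1)}\cdots x_u^{(m_u)} b$; the only further edges added are: for each spoke $(v,u)\in S$, a nonempty set of edges between $v$ and internal vertices of $u$; and for each rung $\{u,u'\}\in R$, a nonempty set of edges between internal vertices of $u$ and internal vertices of $u'$. A graph $G$ contains a pathograph $\mathfrak{F}$ if some induced subgraph of $G$ is isomorphic to a realization of $\mathfrak{F}$. $H$ is an induced minor of $G$ if there are disjoint connected vertex sets $\{C_v\}_{v\in V(H)}$ in $G$ such that some vertex of $C_v$ is adjacent to some vertex of $C_{v'}$ iff $vv'\in E(H)$; $H$ is an induced topological minor of $G$ if some subdivision of $H$ is an induced subgraph of $G$; subgraph, minor and topological minor have their usual meanings. A theta consists of two vertices $a,b$ and three pairwise disjoint, pairwise nonadjacent (apart from $a,b$) induced $a$–$b$ paths, all of length at least 2. A pyramid consists of a vertex $a$, a triangle $b_1b_2b_3$,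 and three disjoint nonadjacent induced paths $P_i$ from $a$ to $b_i$, with $P_1$ of length at least 1 and $P_2,P_3$ of length at least 2. A prism consists of two triangles $a_1a_2a_3$, $b_1b_2b_3$ and three disjoint nonadjacent induced paths $P_i$ from $a_i$ to $b_i$, each of length at least 1. A wheel consists of an induced cycle of length at least 4 plus a vertex with at least 3 neighbours on the cycle. ''Induced theta'' etc. means an induced subgraph that is a theta etc. *)

(* Defs.v *)
From Stdlib Require List.
From mathcomp Require Import all_boot.
Set Implicit Arguments. Unset Strict Implicit. Unset Printing Implicit Defensive.

Record sgraph := SGraph {
  vert :> finType;
  adj : rel vert;
  adj_sym : symmetric adj;
  adj_irr : irreflexive adj }.
Arguments adj : clear implicits.

(* Pathographs (V,U,E,S,R,pi).  V and U are two separate finite types  *)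
(* (hence disjoint); pi u = {pg_end1 u, pg_end2 u} (the order of the   *)
(* two endpoints is irrelevant for realizations, which are symmetric). *)
Record pathograph := Pathograph {
  pgV : finType;
  pgU : finType;
  pgE : rel pgV;
  pgS : pgV -> pgU -> bool;
  pgR : rel pgU;
  pg_end1 : pgU -> pgV;
  pg_end2 : pgU -> pgV;
  pgE_sym : symmetric pgE;
  pgE_irr : irreflexive pgE;
  pgR_sym : symmetric pgR;
  pgR_irr : irreflexive pgR;
  pg_ends_neq : forall u, pg_end1 u != pg_end2 u;
  pg_ends_nonedge : forall u, ~~ pgE (pg_end1 u) (pg_end2 u) }.
Arguments pgE : clear implicits.
Arguments pgS : clear implicits.
Arguments pgR : clear implicits.
Arguments pg_end1 : clear implicits.
Arguments pg_end2 : clear implicits.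

Definition pedges (T : Type) (s : seq T) : seq (T * T) := zip s (behead s).
Definition cedges (T : Type) (s : seq T) : seq (T * T) := zip s (rot 1 s).

Definition path_edge (G : sgraph) (P : pathograph) (f : pgV P -> G)
    (I : pgU P -> seq G) (v : pgV P) (u : pgU P) (x : G) : bool :=
  ((v == pg_end1 P u) && (x == head x (I u))) ||
  ((v == pg_end2 P u) && (x == last x (I u))).

(* G contains P: some induced subgraph of G is (isomorphic to) a
   realization of P.  f maps V into G and I u lists, in order, the
   internal vertices x_u^(1) ... x_u^(m_u) of urpath u.  The induced
   subgraph of G on all these vertices must have exactly the edges
   prescribed by the definition of a realization. *)
Definition contains (G : sgraph) (P : pathograph) : Prop :=
  exists (f : pgV P -> G) (I : pgU P -> seq G),
  [/\ uniq ([seq f v | v <- enum (pgV P)] ++ flatten [seq I u | u <- enum (pgU P)])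
       /\ forall u, 0 < size (I u),
      forall v w, adj G (f v) (f w) = pgE P v w,
      forall u x y, x \in I u -> y \in I u ->
        adj G x y = ((x, y) \in pedges (I u)) || ((y, x) \in pedges (I u)),
      forall v u,
        [/\ forall x, x \in I u -> path_edge f I v u x -> adj G (f v) x,
            ~~ pgS P v u -> forall x, x \in I u -> adj G (f v) x -> path_edge f I v u x
          & pgS P v u -> exists2 x, x \in I u & adj G (f v) x]
    &
      forall u u', u != u' ->
        (pgR P u u' <-> exists x y, [/\ x \in I u, y \in I u' & adj G x y])].

Definition contains_some (G : sgraph) (S : seq pathograph) : Prop :=
  exists2 P, List.In P S & contains G P.

Definition subgraph_of (H G : sgraph) : Prop :=
  exists f : H -> G, injective f /\ forall v w, adj H v w -> adj G (f v) (f w).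

Definition induced_subgraph_of (H G : sgraph) : Prop :=
  exists f : H -> G, injective f /\ forall v w, adj G (f v) (f w) = adj H v w.

Definition connected_set (G : sgraph) (C : {set G}) : Prop :=
  C != set0 /\
  forall x y, x \in C -> y \in C ->
    connect [rel a b | [&& a \in C, b \in C & adj G a b]] x y.

Definition sets_adjacent (G : sgraph) (A B : {set G}) : Prop :=
  exists x y, [/\ x \in A, y \in B & adj G x y].

Definition minor_of (H G : sgraph) : Prop :=
  exists C : H -> {set G},
  [/\ forall v, connected_set (C v),
      forall v w, v != w -> [disjoint C v & C w]
    & forall v w, adj H v w -> sets_adjacent (C v) (C w)].

Definition induced_minor_of (H G : sgraph) : Prop :=
  exists C : H -> {set G},
  [/\ forall v, connected_set (C v),
      forall v w, v != w -> [disjoint C v & C w]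
    & forall v w, v != w -> (adj H v w <-> sets_adjacent (C v) (C w))].

Definition hedges (H : sgraph) : seq (H * H) :=
  enum [pred p : H * H | adj H p.1 p.2 && (enum_rank p.1 < enum_rank p.2)%N].

(* the branch-vertex map f and the internal vertices Q v w of the path
   replacing the edge vw (for (v,w) in hedges H) *)
Definition sd_path (H G : sgraph) (f : H -> G) (Q : H -> H -> seq G)
    (p : H * H) : seq G :=
  f p.1 :: rcons (Q p.1 p.2) (f p.2).

Definition sd_verts (H G : sgraph) (f : H -> G) (Q : H -> H -> seq G) : seq G :=
  [seq f v | v <- enum H] ++ flatten [seq Q p.1 p.2 | p <- hedges H].

Definition sd_edges (H G : sgraph) (f : H -> G) (Q : H -> H -> seq G)
    : seq (G * G) :=
  flatten [seq pedges (sd_path f Q p) | p <- hedges H].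

Definition subdivision_in (H G : sgraph) (f : H -> G) (Q : H -> H -> seq G) : Prop :=
  uniq (sd_verts f Q) /\
  forall p, p \in hedges H -> path (adj G) (f p.1) (rcons (Q p.1 p.2) (f p.2)).

Definition topological_minor_of (H G : sgraph) : Prop :=
  exists (f : H -> G) (Q : H -> H -> seq G), subdivision_in f Q.

Definition induced_topological_minor_of (H G : sgraph) : Prop :=
  exists (f : H -> G) (Q : H -> H -> seq G),
    subdivision_in f Q /\
    forall x y, x \in sd_verts f Q -> y \in sd_verts f Q -> adj G x y ->
      ((x, y) \in sd_edges f Q) || ((y, x) \in sd_edges f Q).

Definition induced_exactly (G : sgraph) (W : seq G) (Es : seq (G * G)) : Prop :=
  forall x y, x \in W -> y \in W ->
    adj G x y = ((x, y) \in Es) || ((y, x) \in Es).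

Definition has_induced_theta (G : sgraph) : Prop :=
  exists (a b : G) (P1 P2 P3 : seq G),
  [/\ uniq (a :: b :: P1 ++ P2 ++ P3),
      P1 != [::], P2 != [::], P3 != [::] &
      induced_exactly (a :: b :: P1 ++ P2 ++ P3)
        (pedges (a :: rcons P1 b) ++ pedges (a :: rcons P2 b)
           ++ pedges (a :: rcons P3 b))].

Definition has_induced_pyramid (G : sgraph) : Prop :=
  exists (a b1 b2 b3 : G) (P1 P2 P3 : seq G),
  [/\ uniq (a :: b1 :: b2 :: b3 :: P1 ++ P2 ++ P3),
      P2 != [::], P3 != [::] &
      induced_exactly (a :: b1 :: b2 :: b3 :: P1 ++ P2 ++ P3)
        ([:: (b1, b2); (b2, b3); (b1, b3)]
           ++ pedges (a :: rcons P1 b1) ++ pedges (a :: rcons P2 b2)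
           ++ pedges (a :: rcons P3 b3))].

Definition has_induced_prism (G : sgraph) : Prop :=
  exists (a1 a2 a3 b1 b2 b3 : G) (P1 P2 P3 : seq G),
  uniq (a1 :: a2 :: a3 :: b1 :: b2 :: b3 :: P1 ++ P2 ++ P3) /\
  induced_exactly (a1 :: a2 :: a3 :: b1 :: b2 :: b3 :: P1 ++ P2 ++ P3)
    ([:: (a1, a2); (a2, a3); (a1, a3); (b1, b2); (b2, b3); (b1, b3)]
       ++ pedges (a1 :: rcons P1 b1) ++ pedges (a2 :: rcons P2 b2)
       ++ pedges (a3 :: rcons P3 b3)).

Definition has_induced_wheel (G : sgraph) : Prop :=
  exists (h : G) (c : seq G),
  [/\ uniq (h :: c), 4 <= size c,
      forall x y, x \in c -> y \in c ->
        adj G x y = ((x, y) \in cedges c) || ((y, x) \in cedges c)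
    & 3 <= count (adj G h) c].

(* Main.v *)
Require Import Defs.
From mathcomp Require Import all_boot zify.
From Stdlib Require Import Classical.
Set Implicit Arguments. Unset Strict Implicit. Unset Printing Implicit Defensive.

(** A property of graphs has a finite basis of pathographs as soon as there is
    a bound [N] such that every graph with the property contains a pathograph
    with at most [N] vertices and [N] urpaths all of whose host graphs have the
    property: up to isomorphism there are finitely many pathographs of size at
    most [N], and one keeps those whose hosts all have the property.

    Such a pathograph is read off as the trace of boundedly many vertices and
    induced paths in [G], its edges, spokes and rungs recording which of these
    pieces see each other in [G].  For (induced) topological minors, thetas,
    pyramids, prisms and wheels the pieces are the branch vertices and the
    subdivided edges, made induced if necessary.  For (induced) minors each
    branch set is shrunk to a union of few induced paths that stays connected
    and keeps a contact with every other branch set it was adjacent to; since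
    only adjacency between whole pieces matters there, spokes and rungs carry
    enough information. *)

(** * Finite bases and traces *)

(** The uniqueness condition of [contains], in pointwise form and without enumerations;
    [uniq_family] proves the equivalence. *)
Definition disjoint_family (V U : Type) (T : eqType) (f : V -> T) (Q : U -> seq T) :=
  [/\ injective f, forall u, uniq (Q u), forall v u, f v \notin Q u
    & forall u u' x, x \in Q u -> x \in Q u' -> u = u'].

Lemma uniq_flatten_map (U T : eqType) (Q : U -> seq T) (t : seq U) :
  uniq t ->
  uniq (flatten [seq Q u | u <- t]) <->
  {in t, forall u, uniq (Q u)} /\
  {in t &, forall u u' x, x \in Q u -> x \in Q u' -> u = u'}.
Proof.
elim: t => [_|u t IH] /=; first by split.
case/andP=> ut /IH {}IH; rewrite cat_uniq; split.
  case/and3P=> uQ /hasPn dQ /IH [IH1 IH2]; split.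
    by move=> w; rewrite inE => /predU1P[->|/IH1].
  have no w x : w \in t -> x \in Q u -> x \in Q w -> False.
    move=> wt xu xw; move: (dQ x); rewrite xu; move/(_ _)/negP; apply=> //.
    by apply/flatten_mapP; exists w.
  move=> w w'; rewrite !inE => /predU1P[->|wt] /predU1P[->|wt'] x xw xw' //.
  - by case: (no w' x).
  - by case: (no w x).
  - exact: IH2 xw xw'.
case=> H1 H2; apply/and3P; split.
- by apply: H1; rewrite inE eqxx.
- apply/hasPn => x /flatten_mapP[w wt xw]; apply/negP => xu.
  move: ut; rewrite (H2 u w _ _ x) ?wt // !inE ?eqxx ?wt ?orbT //.
- apply/IH; split=> [w wt|w w' wt wt']; first by apply: H1; rewrite inE wt orbT.
  by apply: H2; rewrite inE ?wt ?wt' orbT.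
Qed.

Lemma uniq_family (V U : finType) (T : eqType) (f : V -> T) (Q : U -> seq T) :
  uniq ([seq f v | v <- enum V] ++ flatten [seq Q u | u <- enum U]) <->
  disjoint_family f Q.
Proof.
rewrite cat_uniq; split.
  case/and3P=> fU /hasPn dQ /(uniq_flatten_map _ (enum_uniq _)) [H1 H2]; split.
  - exact/injectiveP.
  - by move=> u; apply: H1; rewrite mem_enum.
  - move=> v u; apply/negP=> vu; have /dQ/negP[] : f v \in flatten [seq Q u | u <- enum U].
      by apply/flatten_mapP; exists u; rewrite ?mem_enum.
    by apply: map_f; rewrite mem_enum.
  - by move=> u u'; apply: H2; rewrite mem_enum.
case=> f_inj uQ fQ dQ; apply/and3P; split.
- by rewrite map_inj_uniq ?enum_uniq.
- apply/hasPn => x /flatten_mapP[u _ xu]; apply/negP=> /mapP[v _ xv].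
  by move: (fQ v u); rewrite -xv xu.
- apply/(uniq_flatten_map _ (enum_uniq _)); split=> [u _|u u' _ _]; [exact: uQ|exact: dQ].
Qed.

Definition has_basis (Q : sgraph -> Prop) : Prop :=
  exists S, forall G, Q G <-> contains_some G S.

Lemma contains_some_cat G S1 S2 :
  contains_some G (S1 ++ S2) <-> contains_some G S1 \/ contains_some G S2.
Proof.
elim: S1 => [|P S1 IH] /=; first by split; [right | case=> // -[]].
split.
  case=> P' [<-|inP] cP; first by left; exists P; first left.
  have /IH [[P1 in1 c1]|]: contains_some G (S1 ++ S2) by exists P'.
    by left; exists P1; first right.
  by right.
case=> [[P' [<-|inP] cP]|c2]; first by exists P; first left.
  have [|P1 in1 c1] := proj2 IH; first by left; exists P'.
  by exists P1; first right.
have [|P1 in1 c1] := proj2 IH; first by right.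
by exists P1; first right.
Qed.

(** The bases for the single values of [t] are concatenated. This lets a basis be assembled from one
    small basis per isomorphism code. *)
Lemma has_basis_ex (T : finType) (Q : T -> sgraph -> Prop) :
  (forall t, has_basis (Q t)) -> has_basis (fun G => exists t, Q t G).
Proof.
move=> bQ.
have [S SP] : has_basis (fun G => exists2 t, t \in enum T & Q t G).
  elim: (enum T) => [|t s [S SP]]; first by exists [::] => G; split=> [[]//|[]].
  have [S0 S0P] := bQ t; exists (S0 ++ S) => G; rewrite contains_some_cat -SP -S0P.
  split=> [[u]|[Qt|[u us Qu]]].
  - by rewrite inE => /predU1P[-> Qt|us Qu]; [left | right; exists u].
  - by exists t; rewrite ?mem_head.
  - by exists u; rewrite // inE us orbT.
by exists S => G; rewrite -SP; split=> [[t]|[t]]; exists t; rewrite ?mem_enum.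
Qed.

Definition pg_iso (P P' : pathograph) : Prop :=
  exists (s : pgV P -> pgV P') (t : pgU P -> pgU P'),
  [/\ bijective s, bijective t
    & [/\ forall v w, pgE P' (s v) (s w) = pgE P v w,
          forall v u, pgS P' (s v) (t u) = pgS P v u,
          forall u u', pgR P' (t u) (t u') = pgR P u u',
          forall u, pg_end1 P' (t u) = s (pg_end1 P u)
        & forall u, pg_end2 P' (t u) = s (pg_end2 P u)]].

Lemma pg_iso_contains G P P' : pg_iso P P' -> contains G P' -> contains G P.
Proof.
case=> s [t [/bij_inj s_inj /bij_inj t_inj [eE eS eR e1 e2]]].
case=> f [I [[/uniq_family[f_inj uI fI dI] I0] fE II SI RI]].
have peE v u x : path_edge (f \o s) (I \o t) v u x = path_edge f I (s v) (t u) x.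
  by rewrite /path_edge e1 e2 !(inj_eq s_inj).
exists (f \o s), (I \o t); split=> /=.
- split=> //; apply/uniq_family; split=> //=; first exact: inj_comp.
  by move=> u u' x xu /(dI _ _ _ xu) /t_inj.
- by move=> v w; rewrite fE eE.
- by move=> u x y; apply: II.
- move=> v u; case: (SI (s v) (t u)); rewrite eS => S1 S2 S3; split=> //.
    by move=> x xI; rewrite peE; apply: S1.
  by move=> nS x xI; rewrite peE; apply: S2.
- by move=> u u' uu'; rewrite -eR; apply: RI; rewrite (inj_eq t_inj).
Qed.

(** The complete incidence data of a pathograph whose vertices and urpaths are numbered. Being a
    finite type, it bounds the number of isomorphism classes of a given size. *)
Definition code (n m : nat) : finType :=
  ({ffun 'I_n * 'I_n -> bool} * {ffun 'I_n * 'I_m -> bool} *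
   {ffun 'I_m * 'I_m -> bool} * {ffun 'I_m -> 'I_n} * {ffun 'I_m -> 'I_n})%type.

Definition coded n m (c : code n m) (P : pathograph) : Prop :=
  exists (s : pgV P -> 'I_n) (t : pgU P -> 'I_m),
  [/\ bijective s, bijective t
    & let: (E, Sp, R, e1, e2) := c in
      [/\ forall v w, pgE P v w = E (s v, s w),
          forall v u, pgS P v u = Sp (s v, t u),
          forall u u', pgR P u u' = R (t u, t u'),
          forall u, s (pg_end1 P u) = e1 (t u)
        & forall u, s (pg_end2 P u) = e2 (t u)]].

Lemma coded_ex P : exists c : code #|pgV P| #|pgU P|, coded c P.
Proof.
exists ([ffun p => pgE P (enum_val p.1) (enum_val p.2)],
        [ffun p => pgS P (enum_val p.1) (enum_val p.2)],
        [ffun p => pgR P (enum_val p.1) (enum_val p.2)],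
        [ffun u => enum_rank (pg_end1 P (enum_val u))],
        [ffun u => enum_rank (pg_end2 P (enum_val u))]).
exists (@enum_rank _), (@enum_rank _); split; try exact: enum_rank_bij.
by split=> *; rewrite ffunE /= ?enum_rankK.
Qed.

Lemma coded_iso n m (c : code n m) P P' : coded c P -> coded c P' -> pg_iso P P'.
Proof.
case: c => [[[[E Sp] R] e1] e2].
case=> s [t [bs bt [sE sS sR se1 se2]]] [s' [t' [[is' s'K is'K] [it' t'K it'K] [sE' sS' sR' se1' se2']]]].
exists (is' \o s), (it' \o t); split=> /=.
- by apply: bij_comp bs; exists s'.
- by apply: bij_comp bt; exists t'.
- split=> *; rewrite ?sE' ?sS' ?sR' ?sE ?sS ?sR ?is'K ?it'K //.
    by apply: (can_inj s'K); rewrite se1' is'K it'K se1.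
  by apply: (can_inj s'K); rewrite se2' is'K it'K se2.
Qed.

Lemma finite_basis (Q : sgraph -> Prop) (N : nat) :
  (forall G, Q G -> exists P, [/\ #|pgV P| <= N, #|pgU P| <= N, contains G P
                               & forall G', contains G' P -> Q G']) ->
  has_basis Q.
Proof.
move=> QP.
(* The property is split by the code of the witnessing pathograph. *)
pose Qc n m (c : code n m) G :=
  exists P, [/\ coded c P, contains G P & forall G', contains G' P -> Q G'].
have bQ n m (c : code n m) : has_basis (Qc n m c).
  (* A code is either realized by some pathograph all of whose hosts have the property, and then
     this one represents all others with that code by isomorphism invariance of [contains], or it
     contributes nothing. *)
  case: (classic (exists2 P, coded c P & forall G', contains G' P -> Q G')).
    case=> P cP QPP; exists [:: P] => G; split.
      case=> P' [cP' GP' _]; exists P; first by left.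
      by apply: pg_iso_contains GP'; apply: coded_iso cP cP'.
    by case=> P' [<-|//] GP; exists P.
  move=> no; exists [::] => G; split=> [[P [cP _ QPP]]|[]//].
  by case: no; exists P.
have [S SP] := has_basis_ex (fun n : 'I_N.+1 => has_basis_ex (fun m : 'I_N.+1 =>
  has_basis_ex (fun c => bQ n m c))).
exists S => G; rewrite -SP; split; last by case=> n [m [c [P [_ GP]]]]; apply.
case/QP=> P [nV nU GP QPP]; have [c cP] := coded_ex P.
by exists (Ordinal (n:=N.+1) nV), (Ordinal (n:=N.+1) nU), c, P.
Qed.

Section Trace.
Variables (V U : finType) (e1 e2 : U -> V).

(** The counterpart of [path_edge] for a bare family of lists, where empty lists are allowed. The
    defaults of [head] and [last] are harmless because [x] is taken from [Q u] in the definitions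
    below. *)
Definition path_end (T : eqType) (Q : U -> seq T) v u x :=
  ((v == e1 u) && (x == head x (Q u))) || ((v == e2 u) && (x == last x (Q u))).

(* Induced paths replacing the edges [e1 u, e2 u]; different paths may be
   adjacent to each other in any way. *)
Definition linkage (G : sgraph) (f : V -> G) (Q : U -> seq G) : Prop :=
  [/\ disjoint_family f Q,
      forall u x y, x \in Q u -> y \in Q u ->
        adj G x y = ((x, y) \in pedges (Q u)) || ((y, x) \in pedges (Q u)),
      forall v u x, x \in Q u -> path_end Q v u x -> adj G (f v) x
    & forall u, adj G (f (e1 u)) (f (e2 u)) = nilp (Q u)].

Definition meets (G : sgraph) (f : V -> G) (Q : U -> seq G) v u : Prop :=
  exists2 x, x \in Q u & adj G (f v) x.

Definition meets_at_ends (G : sgraph) (f : V -> G) (Q : U -> seq G) v u : Prop :=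
  forall x, x \in Q u -> adj G (f v) x -> path_end Q v u x.

Definition paths_adjacent (G : sgraph) (Q : U -> seq G) u u' : Prop :=
  exists x y, [/\ x \in Q u, y \in Q u' & adj G x y].

(** What a pathograph remembers of a linkage. The third clause goes one way only: a missing spoke
    confines the contacts to the ends, while a spoke does not promise a contact elsewhere. *)
Definition similar (G : sgraph) (f : V -> G) Q (G' : sgraph) (f' : V -> G') Q' : Prop :=
  [/\ forall v w, adj G' (f' v) (f' w) = adj G (f v) (f w),
      forall v u, meets f Q v u <-> meets f' Q' v u,
      forall v u, meets_at_ends f Q v u -> meets_at_ends f' Q' v u
    & forall u u', u != u' -> paths_adjacent Q u u' <-> paths_adjacent Q' u u'].

(** The pathograph is read off from [G]: edges between images of vertices, spokes for contacts not
    already forced by the urpath, rungs for contacts between paths. Any realization of it is again a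
    linkage with the same trace. *)
Lemma linkage_trace (G : sgraph) (f : V -> G) Q :
  (forall u, e1 u != e2 u) -> linkage f Q ->
  exists P, [/\ #|pgV P| <= #|V|, #|pgU P| <= #|U|, contains G P
    & forall G' : sgraph, contains G' P ->
        exists (f' : V -> G') Q', linkage f' Q' /\ similar f Q f' Q'].
Proof.
move=> e12 [[f_inj uQ fQ dQ] QQ fend fe].
(* A urpath needs an internal vertex, so indices with an empty path are dropped; by the last clause
   of [linkage] they survive as edges of [E]. *)
pose U0 : finType := {u : U | ~~ nilp (Q u)}.
pose E := [rel v w | adj G (f v) (f w)].
(* Only contacts other than the end edges present in every realization make a spoke, so that the
   absence of a spoke forces all contacts to be end edges. *)
pose S v (u : U0) := has (fun x => adj G (f v) x && ~~ path_end Q v (val u) x) (Q (val u)).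
pose R := [rel u u' : U0 | (u != u') && has (fun x => has (adj G x) (Q (val u'))) (Q (val u))].
have E_sym : symmetric E by move=> v w; apply: adj_sym.
have E_irr : irreflexive E by move=> v; apply: adj_irr.
have R_sym : symmetric R.
  move=> u u' /=; rewrite eq_sym; congr (_ && _); apply/hasP/hasP.
    by case=> x xu /hasP[y yu xy]; exists y => //; apply/hasP; exists x; rewrite // adj_sym.
  by case=> x xu /hasP[y yu xy]; exists y => //; apply/hasP; exists x; rewrite // adj_sym.
have R_irr : irreflexive R by move=> u; rewrite /= eqxx.
have Ue (u : U0) : ~~ E (e1 (val u)) (e2 (val u)) by rewrite /= fe (valP u).
pose P := @Pathograph V U0 E S R (e1 \o val) (e2 \o val) E_sym E_irr R_sym R_irr
  (fun u => e12 (val u)) Ue.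
exists P; split=> //; first by rewrite /= card_sig max_card.
  exists f, (Q \o val); split=> //=.
  - split; last by move=> u; rewrite lt0n; apply: (valP u).
    apply/uniq_family; split=> //= u u' x xu xu'; apply: val_inj; exact: dQ xu xu'.
  - by move=> u; apply: QQ.
  - move=> v u; split.
    + by move=> x; apply: fend.
    + move/hasPn=> nS x xu vx; move: (nS x xu); rewrite vx /= negbK; exact.
    + by case/hasP=> x xu /andP[vx _]; exists x.
  - move=> u u' uu'; rewrite uu' /=; split.
      by case/hasP=> x xu /hasP[y yu xy]; exists x, y.
    by case=> x [y [xu yu xy]]; apply/hasP; exists x => //; apply/hasP; exists y.
move=> G' [f' [I [[/uniq_family /= [f'_inj uI fI dI] I0] f'E II SI RI]]].
(* The dropped indices get the empty path back. *)
pose Q' u := if insub u is Some u0 then I u0 else [::].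
have Q'E (u : U0) : Q' (val u) = I u by rewrite /Q' valK.
have Q'nil u : nilp (Q u) -> Q' u = [::].
  by move=> nQ; rewrite /Q' insubF // nQ.
have Q'in u x : x \in Q' u -> exists u0 : U0, u = val u0 /\ x \in I u0.
  by rewrite /Q'; case: insubP => // u0 _ <- xu; exists u0.
have peE v (u0 : U0) x : path_end Q' v (val u0) x = @path_edge G' P f' I v u0 x.
  by rewrite /path_end /path_edge Q'E.
have pend v u (u0 : U0) : v == e1 u \/ v == e2 u -> u = val u0 -> meets f' Q' v u.
  move=> vu uu0; rewrite uu0 in vu *; rewrite /meets Q'E.
  case EI: (I u0) (I0 u0) => [//|a s] _.
  case: vu => vu.
    exists a; rewrite ?mem_head //.
    case: (SI v u0) => S1 _ _; apply: S1; first by rewrite EI mem_head.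
    by rewrite /path_edge /= vu EI /= eqxx.
  exists (last a s); rewrite ?mem_last //.
  case: (SI v u0) => S1 _ _; apply: S1; first by rewrite EI mem_last.
  by rewrite /path_edge /= vu EI /= eqxx orbT.
have pend0 v (u0 : U0) : v == e1 (val u0) \/ v == e2 (val u0) -> meets f Q v (val u0).
  case EI: (Q (val u0)) (valP u0) => [//|a s] _.
  case=> vu.
    exists a; rewrite ?EI ?mem_head //.
    by apply: (@fend _ (val u0)); rewrite ?EI ?mem_head // /path_end vu EI /= eqxx.
  exists (last a s); rewrite ?EI ?mem_last //.
  by apply: (@fend _ (val u0)); rewrite ?EI ?mem_last // /path_end vu EI /= eqxx orbT.
have peV (T : eqType) (q : U -> seq T) v u x : path_end q v u x -> v == e1 u \/ v == e2 u.
  by case/orP=> /andP[-> _]; [left | right].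
exists f', Q'; split; split.
- split=> //.
  + by move=> u; rewrite /Q'; case: insubP.
  + by move=> v u; apply/negP => /Q'in[u0 [_]]; apply/negP.
  + by move=> u u' x /Q'in[u0 [-> xu]] /Q'in[u1 [-> xu']]; rewrite (dI _ _ _ xu xu').
- by move=> u x y /Q'in[u0 [-> xu]]; rewrite Q'E => yu; apply: II.
- by move=> v u x /Q'in[u0 [-> xu]]; rewrite peE; case: (SI v u0) => S1 _ _; apply: S1.
- move=> u; rewrite f'E /= fe; case: (boolP (nilp (Q u))) => nQ.
    by rewrite Q'nil.
  by rewrite (Q'E (Sub u nQ : U0)); apply/esym/negbTE; rewrite /nilp -lt0n.
- by move=> v w; rewrite f'E.
- move=> v u; split.
    case=> x xu vx; have nQ : ~~ nilp (Q u) by case: (Q u) xu.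
    pose u0 : U0 := Sub u nQ.
    (* A contact at an end means that [v] is an endpoint of [u], and endpoints see the path in every
       realization; any other contact is a spoke. *)
    case: (boolP (path_end Q v u x)) => [/peV pe|npe].
      exact: (pend v u u0).
    rewrite /meets (Q'E u0); case: (SI v u0) => _ _; apply.
    by apply/hasP; exists x => //; rewrite vx.
  case=> x' /Q'in[u0 [-> xu]] vx'.
  (* Without a spoke, the contact in [G'] is an end edge, so [v] is an endpoint of [u] and already
     sees the path in [G]. *)
  case: (boolP (S v u0)) => [/hasP[x xu0 /andP[vx _]]|nS]; first by exists x.
  apply: pend0; case: (SI v u0) => _ S2 _; move: (S2 nS _ xu vx').
  by rewrite -peE; apply: peV.
- move=> v u me x /Q'in[u0 [uu0 xu]]; rewrite uu0 in me *; rewrite peE => vx.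
  case: (SI v u0) => _ S2 _; apply: S2 => //.
  by apply/hasPn => y yu; rewrite negb_and negbK -implybE; apply/implyP/me.
- move=> u u' uu'; split.
    case=> x [y [xu yu xy]].
    have nQ : ~~ nilp (Q u) by case: (Q u) xu.
    have nQ' : ~~ nilp (Q u') by case: (Q u') yu.
    have uu0 : (Sub u nQ : U0) != Sub u' nQ' by [].
    have /(RI _ _ uu0) : pgR P (Sub u nQ) (Sub u' nQ').
      rewrite /= uu0 /=; apply/hasP; exists x => //; apply/hasP; exists y => //.
    by rewrite -!Q'E.
  case=> x [y [/Q'in[u0 [uu0 xu]] /Q'in[u1 [uu1 yu]] xy]].
  have u01 : u0 != u1 by move: uu'; rewrite uu0 uu1.
  have : pgR P u0 u1 by apply/(RI _ _ u01); exists x, y.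
  by case/andP=> _ /hasP[z zu /hasP[t tu zt]]; exists z, t; rewrite uu0 uu1.
Qed.

End Trace.

(** The interface used for all the bases below: pathographs disappear, and it remains to find a
    bounded linkage and to carry the property over to every similar one. *)
Lemma linkage_basis (Q : sgraph -> Prop) (N : nat) :
  (forall G, Q G -> exists (V U : finType) (e1 e2 : U -> V) (f : V -> G) I,
     [/\ [/\ #|V| <= N, #|U| <= N & forall u, e1 u != e2 u], linkage e1 e2 f I
       & forall (G' : sgraph) (f' : V -> G') I',
           linkage e1 e2 f' I' -> similar e1 e2 f I f' I' -> Q G']) ->
  has_basis Q.
Proof.
move=> H; apply: (@finite_basis _ N) => G /H[V [U [e1 [e2 [f [I [[nV nU e12] L QI]]]]]]].
have [P [VP UP GP QP]] := linkage_trace e12 L.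
exists P; split=> //; [exact: leq_trans nV | exact: leq_trans nU |].
by move=> G' /QP[f' [I' [L' S']]]; apply: QI L' S'.
Qed.

(** No paths are used: the trace is the graph induced on the image of [H], which may have more edges
    than [H]. *)
Lemma subgraph_basis H : has_basis (subgraph_of H).
Proof.
apply: (@linkage_basis _ #|H|) => G [f [f_inj fH]].
exists H, void, (of_void _), (of_void _), f, (of_void _).
split; [by split=> //; rewrite card_void | by do 2!split=> //; case |].
move=> G' f' I' [[f'_inj _ _ _] _ _ _] [sE _ _ _]; exists f'; split=> // v w vw.
by rewrite sE fH.
Qed.

Lemma induced_subgraph_basis H : has_basis (induced_subgraph_of H).
Proof.
apply: (@linkage_basis _ #|H|) => G [f [f_inj fH]].
exists H, void, (of_void _), (of_void _), f, (of_void _).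
split; [by split=> //; rewrite card_void | by do 2!split=> //; case |].
move=> G' f' I' [[f'_inj _ _ _] _ _ _] [sE _ _ _]; exists f'; split=> // v w.
by rewrite sE fH.
Qed.

(** * Induced paths and topological minors *)

Lemma in_pedges (T : eqType) (a b : T) s x y :
  ((x, y) \in pedges [:: a, b & s]) =
  ((x == a) && (y == b)) || ((x, y) \in pedges (b :: s)).
Proof. by rewrite [LHS]in_cons xpair_eqE. Qed.

Lemma mem_pedges (T : eqType) (s : seq T) x y :
  (x, y) \in pedges s -> x \in s /\ y \in s.
Proof.
case: s => [|a s] //; elim: s a => [|b s IH] a //.
rewrite in_pedges; case/orP=> [/andP[/eqP-> /eqP->]|/IH[xs ys]].
  by rewrite !inE !eqxx ?orbT.
by rewrite !(in_cons a) xs ys !orbT.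
Qed.

Lemma pedges_cat (T : Type) (a : T) s b t :
  pedges (a :: s ++ b :: t) = pedges (a :: rcons s b) ++ pedges (b :: t).
Proof.
elim: s a => [//|c s IH] a.
by rewrite -[LHS]/((a, c) :: pedges (c :: s ++ b :: t)) IH.
Qed.

Lemma pedges_rcons (T : Type) (a : T) s b :
  pedges (a :: rcons s b) = rcons (pedges (a :: s)) (last a s, b).
Proof.
elim: s a => [//|c s IH] a.
by rewrite -[LHS]/((a, c) :: pedges (c :: rcons s b)) IH.
Qed.

Lemma mem_pedges_ends (T : eqType) (a : T) s b x y :
  (x, y) \in pedges (a :: rcons s b) =
  if nilp s then (x == a) && (y == b) else
  [|| (x == a) && (y == head y s), (x, y) \in pedges s
    | (x == last x s) && (y == b)].
Proof.
case: s => [|c s]; first by rewrite inE xpair_eqE.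
by rewrite rcons_cons in_pedges pedges_rcons mem_rcons in_cons xpair_eqE /= [X in _ || X]orbC.
Qed.

Lemma path_pedges (T : eqType) (e : rel T) x p :
  (forall a b, (a, b) \in pedges (x :: p) -> e a b) -> path e x p.
Proof.
elim: p x => [//|y p IH] x H /=; rewrite H ?mem_head // IH // => a b ab.
by apply: H; rewrite in_pedges ab orbT.
Qed.

Lemma pedges_path (T : eqType) (e : rel T) x p a b :
  path e x p -> (a, b) \in pedges (x :: p) -> e a b.
Proof.
elim: p x => [//|y p IH] x /andP[xy yp]; rewrite in_pedges.
by case/orP=> [/andP[/eqP-> /eqP->]|/(IH _ yp)].
Qed.

Section Chordless.
Variable G : sgraph.

Fixpoint chordless (x : G) (p : seq G) : bool :=
  if p is y :: q then
    [&& adj G x y, all (fun z => ~~ adj G x z && (z != x)) q & chordless y q]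
  else true.

Lemma chordless_uniq x p : chordless x p -> uniq (x :: p).
Proof.
elim: p x => [//|y q IH] x /and3P[xy /allP xq /IH uq].
rewrite cons_uniq uq andbT inE negb_or; apply/andP; split.
  by apply: contraTneq xy => ->; rewrite adj_irr.
by apply/negP=> /xq; rewrite eqxx andbF.
Qed.

Lemma chordless_adj x p a b : chordless x p -> a \in x :: p -> b \in x :: p ->
  adj G a b = ((a, b) \in pedges (x :: p)) || ((b, a) \in pedges (x :: p)).
Proof.
elim: p x a b => [|y q IH] x a b.
  by move=> _; rewrite !inE => /eqP-> /eqP->; rewrite adj_irr.
move=> cp; have := chordless_uniq cp; case/and3P: cp => xy /allP xq cq.
rewrite cons_uniq => /andP[xn uq].
have nx c : (x, c) \in pedges (y :: q) = false.
  by apply/negP=> /mem_pedges[]; rewrite (negbTE xn).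
have nx' c : (c, x) \in pedges (y :: q) = false.
  by apply/negP=> /mem_pedges[_]; rewrite (negbTE xn).
have main c : c \in y :: q -> adj G x c = (c == y).
  rewrite inE; case: eqVneq => [-> _|cy /= cq']; first exact: xy.
  by case/andP: (xq c cq') => /negbTE.
have xc c : c \in y :: q -> (c == x) = false.
  by move=> cq'; apply: contraNF xn => /eqP<-.
rewrite !(in_cons x) !in_pedges.
case/predU1P=> [->|aq] /predU1P[->|bq].
- by rewrite adj_irr !nx eqxx /= eq_sym xc ?mem_head.
- by rewrite main // nx nx' eqxx (xc b) //= !orbF.
- by rewrite adj_sym main // nx nx' eqxx (xc a) //= !orbF.
- by rewrite (IH y) // !xc.
Qed.

Lemma chordless_suffix x p s z t : chordless x p -> x :: p = s ++ z :: t -> chordless z t.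
Proof.
elim: s x p => [|y s IH] x p cp; first by case=> <- <-.
case: p cp => [|w p]; first by move=> _ [_ /(congr1 size)]; rewrite size_cat addnS.
by case/and3P=> _ _ cp [_]; apply: IH.
Qed.

Lemma split_last_has (T : Type) (a : pred T) s : has a s ->
  exists s1 z s2, [/\ s = s1 ++ z :: s2, a z & ~~ has a s2].
Proof.
elim: s => [//|x s IH] /=; case: (boolP (has a s)) => [/IH[s1 [z [s2 [-> az ns]]]] _|ns].
  by exists (x :: s1), z, s2.
by rewrite orbF => ax; exists [::], x, s.
Qed.

(** Induction on the path: to prepend [x] to a chordless path from [y], cut at [x] if it already
    occurs there, and otherwise jump to the last neighbour of [x] on it. *)
Lemma chordless_sub x p : path (adj G) x p ->
  exists q, [/\ chordless x q, last x q = last x p & {subset x :: q <= x :: p}].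
Proof.
elim: p x => [|y p IH] x; first by move=> _; exists [::]; split.
case/andP=> xy /IH[q [cq lq sq]].
have [xq|xq] := boolP (x \in y :: q).
  have [s [t Est]] : exists s t, y :: q = s ++ x :: t.
    by case/splitPr: xq => s t; exists s, t.
  exists t; split; first exact: chordless_suffix cq Est.
    by rewrite /= -lq -[RHS]/(last y (y :: q)) Est last_cat.
  move=> z; rewrite !(in_cons x) => /predU1P[->|zt]; first by rewrite eqxx.
  by rewrite sq ?orbT // Est mem_cat in_cons zt !orbT.
have [|s [z [t [Est xz xt]]]] := @split_last_has _ (adj G x) (y :: q).
  by rewrite /= xy.
exists (z :: t); split.
- rewrite /= xz (chordless_suffix cq Est) andbT; apply/allP=> w wt.
  rewrite (hasPn xt) //=; apply: contraNneq xq => <-.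
  by rewrite Est mem_cat in_cons wt !orbT.
- by rewrite /= -lq -[RHS]/(last y (y :: q)) Est last_cat.
- move=> w; rewrite !(in_cons x) => /predU1P[->|wt]; first by rewrite eqxx.
  by rewrite sq ?orbT // Est mem_cat wt orbT.
Qed.
End Chordless.

(** These are the clauses of [linkage] that concern a single path [q] between [a] and [b]. *)
Lemma chordless_link (G : sgraph) (a b : G) q : chordless a (rcons q b) ->
  [/\ adj G a b = nilp q,
      forall x y, x \in q -> y \in q ->
        adj G x y = ((x, y) \in pedges q) || ((y, x) \in pedges q),
      forall x, x \in q -> x == head x q -> adj G a x
    & forall x, x \in q -> x == last x q -> adj G b x].
Proof.
move=> cq; have := chordless_uniq cq.
rewrite cons_uniq rcons_uniq mem_rcons in_cons negb_or -andbA => /and4P[ab aq bq uq].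
have aP : a \in a :: rcons q b by rewrite mem_head.
have bP : b \in a :: rcons q b by rewrite in_cons mem_rcons mem_head orbT.
have qP x : x \in q -> x \in a :: rcons q b.
  by move=> xq; rewrite in_cons mem_rcons in_cons xq !orbT.
have na x : x \in q -> (x == a) = false by apply: contraTF => /eqP->.
have nb x : x \in q -> (x == b) = false by apply: contraTF => /eqP->.
have hq x : ~~ nilp q -> head x q \in q by case: (q) => //= c s _; rewrite mem_head.
have lq x : ~~ nilp q -> last x q \in q by case: (q) => //= c s _; rewrite mem_last.
split.
- rewrite (chordless_adj cq) // !mem_pedges_ends; case: ifPn => [_|nq].
    by rewrite !eqxx.
  apply/negbTE/negP => /orP[]/or3P[/andP[h1 h2]|/mem_pedges[h _]|/andP[h1 h2]].
  + by move: bq; rewrite (eqP h2) hq.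
  + by move: aq; rewrite h.
  + by move: aq; rewrite (eqP h1) lq.
  + by move: ab; rewrite eq_sym h1.
  + by move: bq; rewrite h.
  + by move: ab; rewrite h2.
- move=> x y xq yq; rewrite (chordless_adj cq) ?qP // !mem_pedges_ends.
  have -> : nilp q = false by case: (q) xq.
  by rewrite !na ?nb // !andbF !orbF.
- move=> x xq hx; rewrite (chordless_adj cq) ?(qP x) // !mem_pedges_ends.
  have -> : nilp q = false by case: (q) xq.
  by rewrite eqxx hx.
- move=> x xq lx; rewrite adj_sym (chordless_adj cq) ?(qP x) // !mem_pedges_ends.
  have -> : nilp q = false by case: (q) xq.
  by rewrite eqxx lx !orbT.
Qed.

Lemma linkage_path (V U : finType) (e1 e2 : U -> V) (G : sgraph) (f : V -> G) Q u :
  linkage e1 e2 f Q -> path (adj G) (f (e1 u)) (rcons (Q u) (f (e2 u))).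
Proof.
case=> _ QQ fend fe; apply: path_pedges => a b; rewrite mem_pedges_ends.
case: ifPn => [nQ /andP[/eqP-> /eqP->]|nQ]; first by rewrite fe.
case/or3P=> [/andP[/eqP-> hb]|ab|/andP[la /eqP->]].
- have bQ : b \in Q u by rewrite (eqP hb); case: (Q u) nQ => //= *; rewrite mem_head.
  by apply: (fend _ u) => //; rewrite /path_end eqxx hb.
- by have [aQ bQ] := mem_pedges ab; rewrite (QQ u) // ab.
- have aQ : a \in Q u by rewrite (eqP la); case: (Q u) nQ => //= *; rewrite mem_last.
  by rewrite adj_sym; apply: (fend _ u) => //; rewrite /path_end eqxx la orbT.
Qed.

Section Subdivision.
Variable H : sgraph.

Definition hedge : finType := {p : H * H | p \in hedges H}.
Definition hedge1 (u : hedge) : H := (val u).1.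
Definition hedge2 (u : hedge) : H := (val u).2.

Lemma hedge_neq u : hedge1 u != hedge2 u.
Proof.
have := valP u; rewrite mem_enum inE => /andP[vw _].
by apply: contraTneq vw => vw; rewrite -/(hedge1 u) vw adj_irr.
Qed.

Lemma perm_hedges : perm_eq (hedges H) [seq val u | u <- enum hedge].
Proof.
apply: uniq_perm; rewrite ?enum_uniq ?(map_inj_uniq val_inj) ?enum_uniq //.
move=> p; apply/idP/mapP => [pH|[u _ ->]]; last exact: valP.
by exists (Sub p pH); rewrite ?mem_enum.
Qed.

Lemma sd_vertsP (G : sgraph) (f : H -> G) (Q : H -> H -> seq G) :
  uniq (sd_verts f Q) <-> disjoint_family f (fun u : hedge => Q (hedge1 u) (hedge2 u)).
Proof.
rewrite -uniq_family /sd_verts.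
suff /perm_uniq-> : perm_eq ([seq f v | v <- enum H] ++ flatten [seq Q p.1 p.2 | p <- hedges H])
  ([seq f v | v <- enum H] ++ flatten [seq Q (hedge1 u) (hedge2 u) | u <- enum hedge]) by [].
by rewrite perm_cat2l; apply: perm_flatten; rewrite (perm_trans (perm_map _ perm_hedges)) // -map_comp.
Qed.

Definition hedge_paths (T : Type) (I : hedge -> seq T) (v w : H) : seq T :=
  if insub (v, w) is Some u then I u else [::].

Lemma hedge_pathsE (T : Type) (I : hedge -> seq T) u :
  hedge_paths I (hedge1 u) (hedge2 u) = I u.
Proof. by rewrite /hedge_paths /hedge1 /hedge2 -surjective_pairing valK. Qed.

Lemma eq_disjoint_family (V U : Type) (T : eqType) (f : V -> T) (Q Q' : U -> seq T) :
  Q =1 Q' -> disjoint_family f Q -> disjoint_family f Q'.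
Proof.
move=> eQ [f_inj uQ fQ dQ]; split=> //.
- by move=> u; rewrite -eQ.
- by move=> v u; rewrite -eQ.
- by move=> u u' x; rewrite -!eQ; apply: dQ.
Qed.

Lemma topological_minor_basis : has_basis (topological_minor_of H).
Proof.
apply: (@linkage_basis _ (maxn #|H| #|hedge|)) => G [f [Q [/sd_vertsP[f_inj uQ fQ dQ] pQ]]].
(* Each subdivided edge is replaced by an induced path inside it; disjointness is inherited, and
   contacts between different paths do no harm. *)
have ex u : exists q, chordless (f (hedge1 u)) (rcons q (f (hedge2 u))) /\
                      {subset q <= Q (hedge1 u) (hedge2 u)}.
  have [q [cq lq sq]] := chordless_sub (pQ _ (valP u)).
  case/lastP: q cq lq sq => [|q z] cq; rewrite last_rcons.
    by move/f_inj/eqP; rewrite (negbTE (hedge_neq u)).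
  rewrite last_rcons => zE sq; subst z; exists q; split=> // x xq.
  have := chordless_uniq cq; rewrite cons_uniq rcons_uniq mem_rcons in_cons negb_or.
  case/and3P=> [/andP[_ aq] bq _].
  have := sq x; rewrite !in_cons !mem_rcons !in_cons xq !orbT => /(_ isT).
  case/or3P=> [/eqP xE|/eqP xE|//]; first by move: aq; rewrite -xE xq.
  by move: bq; rewrite -xE xq.
have [I IP] := fin_all_exists ex.
exists H, hedge, hedge1, hedge2, f, I; split.
- by split; rewrite ?leq_maxl ?leq_maxr //; apply: hedge_neq.
- split.
  + split=> //.
    * by move=> u; have [/chordless_uniq] := IP u; rewrite cons_uniq rcons_uniq => /and3P[].
    * by move=> v u; apply: contra (fQ v u); apply: (IP u).2.
    * by move=> u u' x /(IP u).2 xu /(IP u').2; apply: dQ.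
  + by move=> u; have [/chordless_link[]] := IP u.
  + move=> v u x xu; have [/chordless_link[_ _ c1 c2] _] := IP u.
    by case/orP=> /andP[/eqP->]; [apply: c1 | apply: c2].
  + by move=> u; have [/chordless_link[]] := IP u.
(* A linkage indexed by the edges of [H] is itself a subdivision of [H]. *)
move=> G' f' I' L' _; exists f', (hedge_paths I'); split.
  by apply/sd_vertsP; case: L' => /(eq_disjoint_family (fun u => esym (hedge_pathsE I' u))).
move=> p pH; have := linkage_path (Sub p pH : hedge) L'.
by rewrite -hedge_pathsE.
Qed.
End Subdivision.

(** * Induced subdivisions of patterns *)

Section Pattern.
(* [free] marks vertices whose adjacencies are not prescribed (the hub of a
   wheel), [K] prescribes adjacencies between images of vertices, and [Phi] is a
   condition on the set of [u] whose path has no internal vertex. *)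
Variables (V U : finType) (e1 e2 : U -> V) (free : pred V) (K : rel V).
Variable Phi : {ffun U -> bool} -> Prop.

Section Edges.
Variables (T : eqType) (f : V -> T) (Q : U -> seq T).

(** Oriented from [e1 u] to [e2 u]; adjacency is compared with its symmetric closure. *)
Definition pattern_edge x y : bool :=
  [exists u, (x, y) \in pedges (f (e1 u) :: rcons (Q u) (f (e2 u)))].

Definition covered x : Prop :=
  (exists2 v, ~~ free v & x = f v) \/ exists u, x \in Q u.

Hypothesis dfQ : disjoint_family f Q.

Lemma pattern_edgeVV v w :
  pattern_edge (f v) (f w) = [exists u, [&& nilp (Q u), v == e1 u & w == e2 u]].
Proof.
have [f_inj uQ fQ dQ] := dfQ.
apply: eq_existsb => u; rewrite mem_pedges_ends; case: ifPn => nQ.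
  by rewrite !(inj_eq f_inj).
apply/negP=> /or3P[/andP[_ h]|/mem_pedges[h _]|/andP[h _]].
- have := fQ w u; rewrite (eqP h); case: (Q u) nQ => //= a s _.
  by rewrite mem_head.
- by have := fQ v u; rewrite h.
- have := fQ v u; rewrite (eqP h); case: (Q u) nQ => //= a s _.
  by rewrite mem_last.
Qed.

Lemma pattern_edgeVQ v u x : x \in Q u ->
  pattern_edge (f v) x = (v == e1 u) && (x == head x (Q u)).
Proof.
have [f_inj uQ fQ dQ] := dfQ => xu.
have xf w : (x == f w) = false by apply: contraNF (fQ w u) => /eqP<-.
apply/existsP/andP => [[u']|[vu hx]].
  rewrite mem_pedges_ends xf andbF; case: ifPn => // nQ.
  rewrite andbF orbF => /orP[/andP[h1 h2]|/mem_pedges[h _]].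
    have xu' : x \in Q u' by rewrite (eqP h2); case: (Q u') nQ => //= *; rewrite mem_head.
    by rewrite (dQ _ _ _ xu xu') h2 -(inj_eq f_inj) h1.
  by have := fQ v u'; rewrite h.
exists u; rewrite mem_pedges_ends -(eqP vu) eqxx hx.
by case: (Q u) xu.
Qed.

Lemma pattern_edgeQV v u x : x \in Q u ->
  pattern_edge x (f v) = (v == e2 u) && (x == last x (Q u)).
Proof.
have [f_inj uQ fQ dQ] := dfQ => xu.
have xf w : (x == f w) = false by apply: contraNF (fQ w u) => /eqP<-.
apply/existsP/andP => [[u']|[vu lx]].
  rewrite mem_pedges_ends xf /=; case: ifPn => // nQ.
  case/orP=> [/mem_pedges[_ h]|/andP[h1 h2]].
    by have := fQ v u'; rewrite h.
  have xu' : x \in Q u' by rewrite (eqP h1); case: (Q u') nQ => //= *; rewrite mem_last.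
  by rewrite (dQ _ _ _ xu xu') h1 -(inj_eq f_inj) h2.
exists u; rewrite mem_pedges_ends -(eqP vu) eqxx lx !orbT.
by case: (Q u) xu.
Qed.

Lemma pattern_edgeQQ u u' x y : x \in Q u -> y \in Q u' ->
  pattern_edge x y = (u == u') && ((x, y) \in pedges (Q u)).
Proof.
have [f_inj uQ fQ dQ] := dfQ => xu yu'.
have xf w : (x == f w) = false by apply: contraNF (fQ w u) => /eqP<-.
have yf w : (y == f w) = false by apply: contraNF (fQ w u') => /eqP<-.
apply/existsP/andP => [[u0]|[uu' xy]].
  rewrite mem_pedges_ends xf yf /= andbF orbF; case: ifP => // _ xy.
  have [xu0 yu0] := mem_pedges xy.
  by rewrite (dQ _ _ _ xu xu0) (dQ _ _ _ yu' yu0).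
by exists u; rewrite mem_pedges_ends xy /= orbT; case: (Q u) xu.
Qed.
End Edges.

Definition pattern_in (G : sgraph) (f : V -> G) (Q : U -> seq G) : Prop :=
  [/\ disjoint_family f Q, Phi [ffun u => nilp (Q u)],
      forall v w, K v w -> adj G (f v) (f w)
    & forall x y, covered f Q x -> covered f Q y ->
        adj G x y = pattern_edge f Q x y || pattern_edge f Q y x].

Hypothesis e12 : forall u, e1 u != e2 u.
Hypothesis e_free : forall u, ~~ free (e1 u) && ~~ free (e2 u).
Hypothesis Phi_parallel : forall e u u', Phi e -> u != u' ->
  (e1 u' == e1 u) && (e2 u' == e2 u) || (e1 u' == e2 u) && (e2 u' == e1 u) -> ~~ e u'.

(** A pattern is a linkage whose non-free vertices see paths only at the prescribed ends and whose
    distinct paths do not see each other. All of this is recorded by the trace, and so is the set of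
    empty paths, on which [Phi] depends. *)
Lemma pattern_basis :
  has_basis (fun G => exists (f : V -> G) Q, pattern_in f Q).
Proof.
apply: (@linkage_basis _ (maxn #|V| #|U|)) => G [f [Q [dfQ PQ KQ QE]]].
have [f_inj uQ fQ dQ] := dfQ.
exists V, U, e1, e2, f, Q.
have covV v : ~~ free v -> covered f Q (f v) by left; exists v.
have covQ u x : x \in Q u -> covered f Q x by right; exists u.
have vend0 v u x : ~~ free v -> x \in Q u -> adj G (f v) x = path_end e1 e2 Q v u x.
  move=> nv xu; rewrite (QE _ _ (covV v nv) (covQ _ _ xu)).
  by rewrite (pattern_edgeVQ dfQ v xu) (pattern_edgeQV dfQ v xu).
have fe u : adj G (f (e1 u)) (f (e2 u)) = nilp (Q u).
  case/andP: (e_free u) => f1 f2; rewrite (QE _ _ (covV _ f1) (covV _ f2)) !(pattern_edgeVV dfQ).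
  (* The ends of [u] could also be joined by another empty path [u'] with the same ends;
     [Phi_parallel] rules this out. *)
  apply/orP/idP => [[]/existsP[u' /and3P[nQ h1 h2]]|nQ]; last first.
  - by left; apply/existsP; exists u; rewrite nQ !eqxx.
  - have [<-//|uu'] := eqVneq u' u.
    have := Phi_parallel PQ (u := u) (u' := u'); rewrite eq_sym uu' ffunE nQ.
    by rewrite -(eqP h1) -(eqP h2) !eqxx orbT => /(_ isT isT).
  - have [<-//|uu'] := eqVneq u' u.
    have := Phi_parallel PQ (u := u) (u' := u'); rewrite eq_sym uu' ffunE nQ.
    by rewrite -(eqP h1) -(eqP h2) !eqxx => /(_ isT isT).
split; first by rewrite leq_maxl leq_maxr.
  split=> //.
  - move=> u x y xu yu; rewrite (QE _ _ (covQ _ _ xu) (covQ _ _ yu)).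
    by rewrite (pattern_edgeQQ dfQ xu yu) (pattern_edgeQQ dfQ yu xu) eqxx.
  - move=> v u x xu vx; rewrite (vend0 v u) //.
    by case/orP: vx => /andP[/eqP-> _]; case/andP: (e_free u).
move=> G' f' Q' L' [sE sM sA sR]; have [df' QQ' fend' fe'] := L'.
exists f', Q'.
(* Emptiness of a path is visible as adjacency of its two ends, which similarity preserves. *)
have nQ u : nilp (Q' u) = nilp (Q u) by rewrite -fe -fe' sE.
have vend v u x : ~~ free v -> x \in Q' u -> adj G' (f' v) x = path_end e1 e2 Q' v u x.
  move=> nv xu; apply/idP/idP; last exact: fend'.
  by apply: (sA v u) => // y yu; rewrite (vend0 _ u).
split=> //.
- by have -> : [ffun u => nilp (Q' u)] = [ffun u => nilp (Q u)] by apply/ffunP=> u; rewrite !ffunE.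
- by move=> v w /KQ; rewrite sE.
move=> x y [[v nv ->]|[u xu]] [[w nw ->]|[u' yu]].
- rewrite sE (QE _ _ (covV _ nv) (covV _ nw)) !(pattern_edgeVV df', pattern_edgeVV dfQ).
  by congr (_ || _); apply: eq_existsb => u; rewrite nQ.
- by rewrite (pattern_edgeVQ df' v yu) (pattern_edgeQV df' v yu) (vend v u').
- by rewrite (pattern_edgeVQ df' w xu) (pattern_edgeQV df' w xu) adj_sym (vend w u) // orbC.
- rewrite (pattern_edgeQQ df' xu yu) (pattern_edgeQQ df' yu xu) (eq_sym u' u).
  have [uu'|uu'] /= := eqVneq u u'; first by rewrite uu' in xu *; apply: QQ'.
  apply/negP => xy; have /(sR _ _ uu') : paths_adjacent Q' u u' by exists x, y.
  case=> z [t [zu tu zt]]; move: zt; rewrite (QE _ _ (covQ _ _ zu) (covQ _ _ tu)).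
  by rewrite (pattern_edgeQQ dfQ zu tu) (pattern_edgeQQ dfQ tu zu) (eq_sym u' u) (negbTE uu').
Qed.
End Pattern.

Lemma has_basis_iff (Q Q' : sgraph -> Prop) :
  (forall G, Q G <-> Q' G) -> has_basis Q -> has_basis Q'.
Proof. by move=> QQ' [S SP]; exists S => G; rewrite -QQ'. Qed.

Section PlainPattern.
Variables (V U : finType) (e1 e2 : U -> V) (Phi : {ffun U -> bool} -> Prop).

(** Without free vertices every vertex of the pattern is covered, so a pattern is an induced copy
    given by vertex and edge lists, the form in which thetas, pyramids and prisms are defined. *)
Lemma plain_patternP (G : sgraph) (f : V -> G) (Q : U -> seq G) :
  pattern_in e1 e2 pred0 (fun _ _ => false) Phi f Q <->
  let W := [seq f v | v <- enum V] ++ flatten [seq Q u | u <- enum U] in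
  [/\ uniq W, Phi [ffun u => nilp (Q u)]
    & induced_exactly W (flatten [seq pedges (f (e1 u) :: rcons (Q u) (f (e2 u))) | u <- enum U])].
Proof.
have cov x : covered pred0 f Q x <->
    x \in [seq f v | v <- enum V] ++ flatten [seq Q u | u <- enum U].
  rewrite mem_cat; split=> [[[v _ ->]|[u xu]]|/orP[/mapP[v _ ->]|/flatten_mapP[u _ xu]]].
  - by rewrite map_f ?mem_enum.
  - by apply/orP; right; apply/flatten_mapP; exists u; rewrite ?mem_enum.
  - by left; exists v.
  - by right; exists u.
have edg x y : pattern_edge e1 e2 f Q x y =
    ((x, y) \in flatten [seq pedges (f (e1 u) :: rcons (Q u) (f (e2 u))) | u <- enum U]).
  apply/existsP/flatten_mapP => [[u xy]|[u _ xy]]; exists u; rewrite ?mem_enum //.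
split=> /=.
  case=> /uniq_family uW PQ _ QE; split=> // x y /cov cx /cov cy.
  by rewrite -!edg; apply: QE.
case=> /uniq_family dfQ PQ QE; split=> // x y /cov cx /cov cy.
by rewrite !edg; apply: QE.
Qed.
End PlainPattern.

Lemma enum_inord n : enum 'I_n.+1 = [seq inord i | i <- iota 0 n.+1].
Proof.
apply: (inj_map val_inj); rewrite val_enum_ord -map_comp -[LHS]map_id.
by apply/eq_in_map=> i; rewrite mem_iota /= add0n => /inordK->.
Qed.

Lemma induced_topological_minor_basis H : has_basis (induced_topological_minor_of H).
Proof.
apply: (@has_basis_iff _ _ _ (@pattern_basis H (hedge H) (@hedge1 H) (@hedge2 H)
  pred0 (fun _ _ => false) (fun _ => True) (@hedge_neq H) _ _)) => //; last first.
  (* Distinct elements of [hedge H] are never parallel, since each edge is listed once, with its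
     ends in increasing rank. *)
  move=> e u u' _ uu' h; case/negP: uu'.
  have := valP u; have := valP u'; rewrite !mem_enum !inE -!/(hedge1 _) -!/(hedge2 _).
  case/andP=> _ r' /andP[_ r].
  case/orP: h r' => /andP[/eqP h1 /eqP h2] r'.
    by apply/eqP/val_inj; rewrite [val u]surjective_pairing [val u']surjective_pairing; congr pair.
  by move: r'; rewrite h1 h2 ltnNge ltnW.
move=> G.
have pm (T : eqType) (I : hedge H -> seq T) (I' : H * H -> seq T) :
    (forall u, I u = I' (val u)) ->
    perm_eq (flatten [seq I u | u <- enum (hedge H)]) (flatten [seq I' p | p <- hedges H]).
  move=> II'; apply: perm_flatten; rewrite perm_sym (perm_trans (perm_map _ (perm_hedges H))) //.
  by rewrite -map_comp (eq_map II').
split.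
  case=> f [I /plain_patternP[uW _ WE]]; exists f, (hedge_paths I).
  have eW : sd_verts f (hedge_paths I) =i [seq f v | v <- enum H] ++ flatten [seq I u | u <- enum (hedge H)].
    move=> x; rewrite !mem_cat; congr (_ || _); apply/esym/perm_mem/pm => u.
    by rewrite hedge_pathsE.
  have eE : sd_edges f (hedge_paths I) =i
      flatten [seq pedges (f (hedge1 u) :: rcons (I u) (f (hedge2 u))) | u <- enum (hedge H)].
    move=> x; apply/esym/perm_mem/pm => u.
    by rewrite /sd_path hedge_pathsE.
  split; last by move=> x y; rewrite !eW !eE => xW yW; rewrite (WE x y).
  split.
    apply/sd_vertsP; apply: eq_disjoint_family (proj1 (uniq_family _ _) uW).
    by move=> u; rewrite hedge_pathsE.
  move=> p pH; apply: path_pedges => a b ab.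
  have abE : (a, b) \in sd_edges f (hedge_paths I) by apply/flatten_mapP; exists p.
  have sub x : x \in f p.1 :: rcons (hedge_paths I p.1 p.2) (f p.2) -> x \in sd_verts f (hedge_paths I).
    rewrite in_cons mem_rcons in_cons mem_cat => /or3P[/eqP->|/eqP->|xp].
    - by rewrite map_f ?mem_enum.
    - by rewrite map_f ?mem_enum.
    - by apply/orP; right; apply/flatten_mapP; exists p.
  have [/sub aW /sub bW] := mem_pedges ab; rewrite !eW in aW bW.
  by rewrite (WE a b) // -eE abE.
case=> f [Q [[uW pQ] QE]]; exists f, (fun u => Q (hedge1 u) (hedge2 u)).
apply/plain_patternP; split=> //; first exact/uniq_family/sd_vertsP.
have eW : sd_verts f Q =i [seq f v | v <- enum H] ++
    flatten [seq Q (hedge1 u) (hedge2 u) | u <- enum (hedge H)].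
  by move=> x; rewrite !mem_cat; congr (_ || _); apply/esym/perm_mem/pm.
have eE : sd_edges f Q =i flatten [seq pedges
    (f (hedge1 u) :: rcons (Q (hedge1 u) (hedge2 u)) (f (hedge2 u))) | u <- enum (hedge H)].
  by move=> x; apply/esym/perm_mem/pm.
have pE a b : (a, b) \in sd_edges f Q -> adj G a b.
  case/flatten_mapP=> p pH; apply: (pedges_path (pQ p pH)).
move=> x y; rewrite -!eW -!eE => xW yW; apply/idP/orP; first by move=> xy; apply/orP; apply: QE.
by case=> /pE; rewrite // adj_sym.
Qed.

(** * Thetas, pyramids and prisms as patterns *)

Lemma theta_basis : has_basis has_induced_theta.
Proof.
(* Three parallel paths between two vertices. Requiring all of them to be nonempty expresses length
   at least 2 and also settles the condition on parallel paths. *)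
apply: (@has_basis_iff _ _ _ (@pattern_basis 'I_2 'I_3 (fun=> inord 0) (fun=> inord 1)
  pred0 (fun _ _ => false) (fun e => forall u, ~~ e u) _ _ _)) => //; last first.
  by move=> *; rewrite -val_eqE /= !inordK.
move=> G; split.
  case=> f [Q /plain_patternP]; rewrite !enum_inord /= !cats0 => -[uW nQ QE].
  exists (f (inord 0)), (f (inord 1)), (Q (inord 0)), (Q (inord 1)), (Q (inord 2)).
  have {}nQ u : Q u != [::] by have := nQ u; rewrite ffunE; case: (Q u).
  by split.
case=> a [b [P1 [P2 [P3 [uW n1 n2 n3 QE]]]]].
exists (fun i : 'I_2 => nth a [:: a; b] i), (fun i : 'I_3 => nth [::] [:: P1; P2; P3] i).
apply/plain_patternP; rewrite !enum_inord /= !inordK //= !cats0; split=> //.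
by move=> [[|[|[|u]]] //= ltu]; rewrite ffunE /nilp size_eq0.
Qed.

Lemma pyramid_basis : has_basis has_induced_pyramid.
Proof.
(* Vertex 0 is the apex and 1, 2, 3 form the triangle. Paths 0 to 2 are the triangle edges, forced
   to be empty; paths 3 to 5 are the legs, of which only path 3 may be empty. *)
pose e1 (u : 'I_6) : 'I_4 := inord (nth 0 [:: 1; 2; 1; 0; 0; 0] u).
pose e2 (u : 'I_6) : 'I_4 := inord (nth 0 [:: 2; 3; 3; 1; 2; 3] u).
apply: (@has_basis_iff _ _ _ (@pattern_basis 'I_4 'I_6 e1 e2
  pred0 (fun _ _ => false) (fun e => forall u : 'I_6, if u < 3 then e u else (u == 3 :> nat) || ~~ e u)
  _ _ _)) => //; last 2 first.
- by case=> -[|[|[|[|[|[|u]]]]]] //= ltu; rewrite -val_eqE /= !inordK.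
- move=> e [u ltu] [u' ltu'] _; rewrite -!val_eqE /=.
  by do 6?[case: u ltu => [|u] ltu //]; do 6?[case: u' ltu' => [|u'] ltu' //];
     rewrite /= !inordK.
move=> G; split.
  case=> f [Q /plain_patternP]; rewrite !enum_inord /= !cats0 => -[uW nQ QE].
  have nQ0 (u : 'I_6) : u < 3 -> Q u = [::].
    by move=> u3; have := nQ u; rewrite u3 ffunE; case: (Q u).
  have nQ1 (u : 'I_6) : 3 < u -> Q u != [::].
    by move=> u3; have := nQ u; rewrite ffunE ltnNge (ltnW u3) gtn_eqF //=; case: (Q u).
  exists (f (inord 0)), (f (inord 1)), (f (inord 2)), (f (inord 3)).
  exists (Q (inord 3)), (Q (inord 4)), (Q (inord 5)).
  move: uW QE; rewrite /e1 /e2 !inordK //= (nQ0 (inord 0)) ?(nQ0 (inord 1)) ?(nQ0 (inord 2)) ?inordK //.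
  by move=> uW QE; split=> //; apply: nQ1; rewrite inordK.
case=> a [b1 [b2 [b3 [P1 [P2 [P3 [uW n2 n3 QE]]]]]]].
exists (fun i : 'I_4 => nth a [:: a; b1; b2; b3] i), (fun i : 'I_6 => nth [::] [:: [::]; [::]; [::]; P1; P2; P3] i).
apply/plain_patternP; rewrite !enum_inord /= /e1 /e2 !inordK //= ?cats0; split=> //.
by move=> [[|[|[|[|[|[|u]]]]]] //= ltu]; rewrite ffunE /nilp ?size_eq0.
Qed.

Lemma prism_basis : has_basis has_induced_prism.
Proof.
(* Vertices 0, 1, 2 and 3, 4, 5 form the triangles. Paths 0 to 5 are the triangle edges, forced to
   be empty; paths 6 to 8 join the triangles and are unrestricted. *)
pose e1 (u : 'I_9) : 'I_6 := inord (nth 0 [:: 0; 1; 0; 3; 4; 3; 0; 1; 2] u).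
pose e2 (u : 'I_9) : 'I_6 := inord (nth 0 [:: 1; 2; 2; 4; 5; 5; 3; 4; 5] u).
apply: (@has_basis_iff _ _ _ (@pattern_basis 'I_6 'I_9 e1 e2
  pred0 (fun _ _ => false) (fun e => forall u : 'I_9, u < 6 -> e u)
  _ _ _)) => //; last 2 first.
- by case=> -[|[|[|[|[|[|[|[|[|u]]]]]]]]] //= ltu; rewrite -val_eqE /= !inordK.
- move=> e [u ltu] [u' ltu'] _; rewrite -!val_eqE /=.
  by do 9?[case: u ltu => [|u] ltu //]; do 9?[case: u' ltu' => [|u'] ltu' //];
     rewrite /= !inordK.
move=> G; split.
  case=> f [Q /plain_patternP]; rewrite !enum_inord /= !cats0 => -[uW nQ QE].
  have nQ0 (u : 'I_9) : u < 6 -> Q u = [::].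
    by move=> u3; have := nQ u u3; rewrite ffunE; case: (Q u).
  exists (f (inord 0)), (f (inord 1)), (f (inord 2)), (f (inord 3)), (f (inord 4)), (f (inord 5)).
  exists (Q (inord 6)), (Q (inord 7)), (Q (inord 8)).
  by move: uW QE; rewrite /e1 /e2 !inordK //= ?(nQ0 (inord 0)) ?(nQ0 (inord 1)) ?(nQ0 (inord 2)) ?(nQ0 (inord 3)) ?(nQ0 (inord 4)) ?(nQ0 (inord 5)) ?inordK //.
case=> a1 [a2 [a3 [b1 [b2 [b3 [P1 [P2 [P3 [uW QE]]]]]]]]].
exists (fun i : 'I_6 => nth a1 [:: a1; a2; a3; b1; b2; b3] i).
exists (fun i : 'I_9 => nth [::] [:: [::]; [::]; [::]; [::]; [::]; [::]; P1; P2; P3] i).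
apply/plain_patternP; rewrite !enum_inord /= /e1 /e2 !inordK //= ?cats0; split=> //.
by move=> [[|[|[|[|[|[|[|[|[|u]]]]]]]]] //= ltu]; rewrite ffunE.
Qed.

(** * Wheels: a cycle cut at three neighbours of the hub *)

Lemma cedges_pedges (T : Type) (a : T) s : cedges (a :: s) = pedges (a :: rcons s a).
Proof.
rewrite /cedges rot1_cons; move: {2 4}a => b.
by elim: s a => [//|c s IH] a; rewrite rcons_cons /= IH.
Qed.

Lemma mem_cedges_catC (T : eqType) (s t : seq T) : cedges (s ++ t) =i cedges (t ++ s).
Proof.
case: s t => [|a s] [|b t] p; rewrite ?cats0 // !cat_cons !cedges_pedges !rcons_cat !rcons_cons.
by rewrite !pedges_cat !mem_cat orbC.
Qed.

Lemma split_first_has (T : Type) (a : pred T) s : has a s ->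
  exists s1 z s2, [/\ s = s1 ++ z :: s2, a z & ~~ has a s1].
Proof.
elim: s => [//|x s IH] /=; case: (boolP (a x)) => ax; first by exists [::], x, s.
case/IH=> s1 [z [s2 [-> az Ec]]]; exists (x :: s1), z, s2.
by rewrite /= (negbTE ax).
Qed.

Lemma split_first_count (T : Type) (a : pred T) s : 0 < count a s ->
  exists s1 z s2, [/\ s = s1 ++ z :: s2, a z & count a s = (count a s2).+1].
Proof.
rewrite -has_count => /split_first_has[s1 [z [s2 [-> az ns1]]]].
exists s1, z, s2; split=> //; rewrite count_cat /= az.
by move: ns1; rewrite has_count -leqNgt leqn0 => /eqP->.
Qed.

Section Wheel.

(** Vertices 0, 1, 2 are three neighbours of the hub on the cycle, path [i] runs from [i] to [i + 1]
    modulo 3, and vertex 3 is the hub. The hub is free, so further neighbours on the cycle remain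
    possible. *)
Definition rim1 (u : 'I_3) : 'I_4 := inord u.
Definition rim2 (u : 'I_3) : 'I_4 := inord (nth 0 [:: 1; 2; 0] u).
Definition hub : pred 'I_4 := fun v => v == 3 :> nat.
Definition hub_adj : rel 'I_4 := fun v w => hub v && ~~ hub w.

Definition rim (T : Type) (f : 'I_4 -> T) (Q : 'I_3 -> seq T) : seq T :=
  f (inord 0) :: Q (inord 0) ++ f (inord 1) :: Q (inord 1) ++ f (inord 2) :: Q (inord 2).

Lemma ord3P (P : 'I_3 -> Prop) : P (inord 0) -> P (inord 1) -> P (inord 2) -> forall u, P u.
Proof.
move=> P0 P1 P2 u; rewrite -(inord_val u).
by case: u => -[|[|[|u]]].
Qed.

Variables (T : eqType) (f : 'I_4 -> T) (Q : 'I_3 -> seq T).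

Lemma rim_edge x y : pattern_edge rim1 rim2 f Q x y = ((x, y) \in cedges (rim f Q)).
Proof.
rewrite cedges_pedges /rim !(rcons_cat, rcons_cons) !pedges_cat !mem_cat.
apply/existsP/or3P.
  case; apply: ord3P; rewrite /rim1 /rim2 !inordK //=; [exact: Or31|exact: Or32|exact: Or33].
by case=> xy; [exists (inord 0) | exists (inord 1) | exists (inord 2)];
  rewrite /rim1 /rim2 !inordK.
Qed.

Lemma rim_covered x : covered hub f Q x <-> x \in rim f Q.
Proof.
rewrite /rim !(in_cons, mem_cat); split.
  case=> [[v nv ->]|[u]].
    rewrite -(inord_val v); case: v nv => -[|[|[|[|v]]]] //= _ _;
      by rewrite eqxx ?orbT.
  by move: u; apply: ord3P => ->; rewrite ?orbT.
have nf k : k < 3 -> ~~ hub (inord k).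
  by move=> k3; rewrite /hub inordK; lia.
case/orP=> [/eqP->|/orP[xu|/orP[/eqP->|/orP[xu|/orP[/eqP->|xu]]]]].
- by left; exists (inord 0); rewrite ?nf.
- by right; exists (inord 0).
- by left; exists (inord 1); rewrite ?nf.
- by right; exists (inord 1).
- by left; exists (inord 2); rewrite ?nf.
- by right; exists (inord 2).
Qed.

Lemma rim_uniq : uniq (f (inord 3) :: rim f Q) <-> disjoint_family f Q.
Proof.
rewrite -uniq_family; set W := _ ++ _.
suff /perm_uniq-> : perm_eq (f (inord 3) :: rim f Q) W by [].
rewrite /W !enum_inord; apply/permP => p; rewrite /rim /=; do 4?rewrite !count_cat /=; lia.
Qed.
End Wheel.

Lemma wheel_basis : has_basis has_induced_wheel.
Proof.
(* Some path being nonempty says exactly that the cycle has at least 4 vertices. *)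
apply: (@has_basis_iff _ _ _ (@pattern_basis 'I_4 'I_3 rim1 rim2 hub hub_adj
  (fun e => exists u, ~~ e u) _ _ _)); last 3 first.
- by apply: ord3P; rewrite -val_eqE /= !inordK //= !inordK.
- by apply: ord3P; rewrite /hub /= !inordK //= !inordK.
- move=> e u u' _; move: u u'; apply: ord3P; apply: ord3P;
    rewrite -!val_eqE /= !inordK //= !inordK //.
move=> G; split.
  case=> f [Q [/rim_uniq uc [u]]]; rewrite ffunE => nQ KQ QE.
  exists (f (inord 3)), (rim f Q); split=> //.
  - by move: u nQ; apply: ord3P; rewrite /rim /= !size_cat /= !size_cat /= /nilp; lia.
  - by move=> x y /rim_covered cx /rim_covered cy; rewrite -!rim_edge; apply: QE.
  - rewrite /rim /= !count_cat /= !count_cat /= !KQ /hub_adj /hub ?inordK //; lia.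
case=> h [c [uc c4 cE c3]].
have [s0 [v0 [t0 [Ec a0 n0]]]] := split_first_count (leq_trans (isT : 0 < 3) c3).
rewrite n0 ltnS in c3.
have [s1 [v1 [t1 [Et0 a1 n1]]]] := split_first_count (leq_trans (isT : 0 < 2) c3).
rewrite n1 ltnS in c3; have [s2 [v2 [s3 [Et1 a2 _]]]] := split_first_count c3.
pose f (i : 'I_4) := nth h [:: v0; v1; v2; h] i.
(* The third path wraps around the end of [c], so it continues with the part [s0] before [v0]; the
   rim is then a rotation of [c]. *)
pose Q (i : 'I_3) := nth [::] [:: s1; s2; s3 ++ s0] i.
have Ecr : rim f Q = (v0 :: t0) ++ s0.
  rewrite Et0 Et1 /rim /f /Q !inordK //=.
  by do 3?rewrite -!catA /=.
have cr : rim f Q =i c by move=> x; rewrite Ecr Ec !mem_cat orbC.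
have ce : cedges (rim f Q) =i cedges c by move=> p; rewrite Ecr Ec mem_cedges_catC.
exists f, Q; split.
- apply/rim_uniq; rewrite cons_uniq cr Ecr uniq_catC -Ec.
  by rewrite /f inordK.
- have := c4; rewrite Ec size_cat addnC -size_cat -Ecr /rim /= !size_cat /= !size_cat /= => sz.
  apply: NNPP => no; have nQ u : size (Q u) = 0.
    by apply/eqP/negP => nu; apply: no; exists u; rewrite ffunE; apply/negP.
  by move: sz; rewrite !nQ.
- move=> v w /andP[/eqP hv]; rewrite /f hv /=.
  by case: w => -[|[|[|[|w]]]] //=.
- move=> x y /rim_covered cx /rim_covered cy; rewrite !rim_edge !ce.
  by apply: cE; rewrite -cr.
Qed.

(** * Minors *)

Section Connected.
Variable G : sgraph.
Implicit Types A B C : {set G}.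

Definition within C : rel G := [rel a b | [&& a \in C, b \in C & adj G a b]].

Lemma within_sym C : connect_sym (within C).
Proof. by apply: sym_connect_sym => a b; rewrite /within /= adj_sym andbCA. Qed.

Lemma within_sub A B : A \subset B -> subrel (connect (within A)) (connect (within B)).
Proof.
move/subsetP=> AB; apply: connect_sub => x y /and3P[xA yA xy].
by apply: connect1; rewrite /within /= xy !AB.
Qed.

Lemma connected_set1 (x : G) : connected_set [set x].
Proof.
split; first by apply/set0Pn; exists x; rewrite inE.
by move=> y z; rewrite !inE => /eqP-> /eqP->.
Qed.

Lemma connected_setU A B : connected_set A -> connected_set B ->
  sets_adjacent A B -> connected_set (A :|: B).
Proof.
move=> [A0 cA] [B0 cB] [a [b [aA bB ab]]]; split.
  by apply/set0Pn; exists a; rewrite inE aA.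
have toa x : x \in A :|: B -> connect (within (A :|: B)) x a.
  rewrite inE => /orP[xA|xB]; first exact: within_sub (subsetUl _ _) _ _ (cA _ _ xA aA).
  apply: connect_trans (within_sub (subsetUr _ _) (cB _ _ xB bB)) _.
  by apply: connect1; rewrite /within /= !inE aA bB orbT adj_sym.
move=> x y xAB yAB; apply: connect_trans (toa x xAB) _.
by rewrite within_sym; apply: toa.
Qed.

Lemma path_connected (x : G) p :
  path (adj G) x p -> connected_set [set z in x :: p].
Proof.
elim: p x => [|y p IH] x.
  by move=> _; rewrite (_ : [set z in _] = [set x]); [apply: connected_set1 | apply/setP=> z; rewrite !inE].
case/andP=> xy /IH cp; rewrite (_ : [set z in _] = [set x] :|: [set z in y :: p]).
  apply: connected_setU cp _; first exact: connected_set1.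
  by exists x, y; rewrite !inE !eqxx.
by apply/setP=> z; rewrite !inE.
Qed.

Lemma path_within C x p : path (within C) x p -> path (adj G) x p /\ {subset p <= C}.
Proof.
elim: p x => [//|y p IH] x /andP[/and3P[_ yC xy] /IH[yp pC]]; split=> /=.
  by rewrite xy.
by move=> z; rewrite inE => /predU1P[->|/pC].
Qed.

Lemma chordless_path x p : chordless x p -> path (adj G) x p.
Proof. by elim: p x => [//|y p IH] x /and3P[/= -> _ /IH]. Qed.

(** A path is stored as its first vertex and the rest, so that it is never empty. *)
Definition piece (s : G * seq G) : seq G := s.1 :: s.2.
Definition pieces (L : seq (G * seq G)) : seq G := flatten [seq piece s | s <- L].

Definition piece_system (L : seq (G * seq G)) : Prop :=
  {in L, forall s, chordless s.1 s.2} /\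
  {in L &, forall s s' x, x \in piece s -> x \in piece s' -> s = s'}.

(* New terminals are attached along an induced path ending next to the pieces
   built so far. *)
Lemma connecting_pieces C (T : seq G) :
  connected_set C -> {subset T <= C} -> T != [::] ->
  exists L, [/\ size L <= size T, piece_system L, {subset T <= pieces L},
    {subset pieces L <= C} & connected_set [set z in pieces L]].
Proof.
move=> [C0 cC]; elim: T => [//|t [_ TC _|t' T IH TC _]].
  exists [:: (t, [::])]; split=> //.
  - by split=> [s|s s']; rewrite !inE => /eqP-> // /eqP->.
  - by rewrite (_ : [set z in _] = [set t]); [apply: connected_set1 | apply/setP=> z; rewrite !inE].
have [|//|L [sL [cL dL] TL LC LK]] := IH; first by move=> x xT; apply: TC; rewrite inE xT orbT.
have [tK|tK] := boolP (t \in pieces L).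
  exists L; split=> //; first exact: leqW.
  by move=> x; rewrite inE => /predU1P[->|/TL].
have tC : t \in C by apply: TC; rewrite mem_head.
have [k kK] : exists k, k \in pieces L by have [/set0Pn[k]] := LK; rewrite inE; exists k.
have /connectP[p pC kE] := cC _ _ tC (LC _ kK).
(* [z] is the first vertex of the walk lying on an old piece, so [t :: p1] avoids the old pieces and
   ends next to them. *)
have /split_first_has[p1 [z [p2 [Ep zK p1K]]]] : has (mem (pieces L)) p.
  apply/hasP; exists k => //; have : k \in t :: p by rewrite kE mem_last.
  by rewrite inE => /predU1P[kt|//]; rewrite kt in kK; rewrite kK in tK.
have [pG {}pC] := path_within pC.
move: pG; rewrite Ep cat_path /= => /and3P[p1G lz _].
have [q [cq lq sq]] := chordless_sub p1G.
have qK x : x \in t :: q -> x \notin pieces L.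
  by move/sq; rewrite inE => /predU1P[->//|xp1]; apply: (hasPn p1K).
have inL s x : s \in L -> x \in piece s -> x \in pieces L.
  by move=> sL' xs; apply/flatten_mapP; exists s.
exists ((t, q) :: L); split.
- by rewrite /= ltnS.
- split=> [s|s s']; rewrite inE; first by case/predU1P=> [->|/cL].
  case/predU1P=> [->|sL']; rewrite inE => /predU1P[->|sL''] x // xs xs'.
  + by have := qK x xs; rewrite (inL _ _ sL'' xs').
  + by have := qK x xs'; rewrite (inL _ _ sL' xs).
  + exact: dL xs xs'.
- move=> x; rewrite -[pieces _]/((t :: q) ++ pieces L) mem_cat in_cons.
  by case/predU1P=> [->|/TL->]; rewrite ?mem_head ?orbT.
- move=> x; rewrite -[pieces _]/((t :: q) ++ pieces L) mem_cat => /orP[/sq|/LC//].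
  by rewrite inE => /predU1P[->//|xp]; apply: pC; rewrite Ep mem_cat xp.
- rewrite (_ : [set z in _] = [set x in t :: q] :|: [set x in pieces L]).
    apply: connected_setU LK _; first exact/path_connected/chordless_path.
    by exists (last t p1), z; rewrite !inE; split=> //; rewrite -lq -in_cons mem_last.
  by apply/setP=> x; rewrite !in_set -[pieces (_ :: _)]/((t :: q) ++ pieces L) mem_cat.
Qed.
End Connected.

(** * Connectivity and contacts carried over between similar linkages *)

Section Blobs.
Variables (V U : finType) (e1 e2 : U -> V).

(** The units between which a trace records adjacency: single vertices and path interiors. *)
Definition blob (G : sgraph) (f : V -> G) (Q : U -> seq G) (b : V + U) : {set G} :=
  match b with inl v => [set f v] | inr u => [set x in Q u] end.

Lemma blob_disjoint (G : sgraph) (f : V -> G) (Q : U -> seq G) b b' x :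
  disjoint_family f Q -> x \in blob f Q b -> x \in blob f Q b' -> b = b'.
Proof.
case=> f_inj _ fQ dQ; case: b b' => [v|u] [w|u'] /=; rewrite !inE.
- by move=> /eqP-> /eqP/f_inj->.
- by move=> /eqP-> h; have := fQ v u'; rewrite h.
- by move=> h /eqP h'; have := fQ w u; rewrite -h' h.
- by move=> xu /(dQ _ _ _ xu)->.
Qed.

Lemma blob_connected (G : sgraph) (f : V -> G) (Q : U -> seq G) b :
  linkage e1 e2 f Q -> blob f Q b != set0 -> connected_set (blob f Q b).
Proof.
case: b => [v|u] L /=; first by move=> _; apply: connected_set1.
have := linkage_path u L; case: (Q u) => [|a s].
  by move=> _ /set0Pn[x]; rewrite !inE.
by rewrite rcons_cons /= rcons_path => /and3P[_ sP _] _; apply: path_connected.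
Qed.

Variables (G G' : sgraph) (f : V -> G) (Q : U -> seq G) (f' : V -> G') (Q' : U -> seq G').
Hypotheses (L : linkage e1 e2 f Q) (L' : linkage e1 e2 f' Q').
Hypothesis S : similar e1 e2 f Q f' Q'.

Lemma similar_blob0 b : (blob f' Q' b == set0) = (blob f Q b == set0).
Proof.
case: b => [v|u] /=.
  by apply/idP/idP => /eqP/setP; [move/(_ (f' v)) | move/(_ (f v))]; rewrite !inE eqxx.
have nil0 (T : finType) (s : seq T) : ([set x in s] == set0) = nilp s.
  case: s => [|a s]; first by apply/eqP/setP=> x; rewrite !inE.
  by apply/negP=> /eqP/setP/(_ a); rewrite !inE eqxx.
by rewrite !nil0; case: L L' S => _ _ _ fe [_ _ _ fe'] [sE _ _ _]; rewrite -fe -fe' sE.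
Qed.

Lemma similar_blob_adjacent b b' : b != b' ->
  sets_adjacent (blob f Q b) (blob f Q b') <-> sets_adjacent (blob f' Q' b) (blob f' Q' b').
Proof.
case: S => sE sM _ sR.
have adjVV (T : sgraph) (g : V -> T) v w : sets_adjacent [set g v] [set g w] <-> adj T (g v) (g w).
  split=> [[x [y []]]|vw]; first by rewrite !inE => /eqP-> /eqP->.
  by exists (g v), (g w); rewrite !inE.
have adjVQ (T : sgraph) (g : V -> T) I v u : sets_adjacent [set g v] [set x in I u] <-> meets g I v u.
  split=> [[x [y []]]|[x xu vx]]; first by rewrite !inE => /eqP-> yu vy; exists y.
  by exists (g v), x; rewrite !inE.
have adjQQ (T : sgraph) (I : U -> seq T) u u' :
    sets_adjacent [set x in I u] [set x in I u'] <-> paths_adjacent I u u'.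
  by split=> -[x [y []]]; rewrite ?inE => xu yu xy; exists x, y; rewrite ?inE.
have adjC (T : sgraph) (A B : {set T}) : sets_adjacent A B <-> sets_adjacent B A.
  by split=> -[x [y [xA yB xy]]]; exists y, x; rewrite adj_sym.
case: b b' => [v|u] [w|u'] /= bb'.
- by rewrite !adjVV sE.
- by rewrite !adjVQ.
- by rewrite adjC [X in _ <-> X]adjC !adjVQ.
- by rewrite !adjQQ; apply: sR.
Qed.
End Blobs.

(** A path in the union of the [D b] passes through a sequence of blobs, consecutive ones equal or
    adjacent. The corresponding [D' b] are connected and adjacent in the same order, so the path can
    be followed there. *)
Lemma bigcup_connected_transfer (B : finType) (P : pred B) (G G' : sgraph)
    (D : B -> {set G}) (D' : B -> {set G'}) :
  (forall b b' x, x \in D b -> x \in D b' -> b = b') ->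
  (forall b, P b -> connected_set (D' b)) ->
  (forall b, P b -> D b != set0) ->
  (forall b b', b != b' -> sets_adjacent (D b) (D b') -> sets_adjacent (D' b) (D' b')) ->
  connected_set (\bigcup_(b | P b) D b) -> connected_set (\bigcup_(b | P b) D' b).
Proof.
move=> dD cD' D0 aD [C0 cC].
have sub b : P b -> D' b \subset \bigcup_(b | P b) D' b by apply: bigcup_sup.
have path_ok x p : path (within (\bigcup_(b | P b) D b)) x p ->
  forall b b' x' y', P b -> P b' -> x \in D b -> last x p \in D b' -> x' \in D' b -> y' \in D' b' ->
  connect (within (\bigcup_(b | P b) D' b)) x' y'.
  elim: p x => [|z p IH] x /=.
    move=> _ b b' x' y' Pb _ xb xb'; rewrite -(dD _ _ _ xb xb') => xb1 yb1.
    exact: within_sub (sub b Pb) _ _ ((cD' b Pb).2 _ _ xb1 yb1).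
  case/andP=> /and3P[_ /bigcupP[c Pc zc] xz] zp b b' x' y' Pb Pb' xb lb' xb1 yb1.
  have [bc|bc] := eqVneq b c; first by rewrite -bc in zc; exact: IH zp _ _ _ _ Pb Pb' zc lb' xb1 yb1.
  have [s [t [sb tc st]]] : sets_adjacent (D' b) (D' c) by apply: aD => //; exists x, z.
  apply: connect_trans (IH z zp _ _ _ _ Pc Pb' zc lb' tc yb1).
  apply: connect_trans (within_sub (sub b Pb) ((cD' b Pb).2 _ _ xb1 sb)) _.
  by apply: connect1; rewrite /within /= st (subsetP (sub b Pb)) // (subsetP (sub c Pc)).
split.
  have /set0Pn[x /bigcupP[b Pb _]] := C0.
  have /set0Pn[y yb] := (cD' b Pb).1.
  by apply/set0Pn; exists y; apply: (subsetP (sub b Pb)).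
move=> x' y' /bigcupP[b Pb xb'] /bigcupP[c Pc yc'].
have /set0Pn[x xb] := D0 b Pb; have /set0Pn[y yc] := D0 c Pc.
have /connectP[p pP lE] : connect (within (\bigcup_(b | P b) D b)) x y.
  by apply: cC; apply/bigcupP; [exists b | exists c].
by apply: path_ok pP _ _ _ _ Pb Pc xb _ xb' yc'; rewrite -lE.
Qed.

Lemma rcons_interior (T : Type) (x : T) p : ~~ nilp p ->
  p = rcons (behead (belast x p)) (last x p).
Proof. by case/lastP: p => [//|q z] _; rewrite belast_rcons last_rcons. Qed.

Lemma card_le_size (T : choiceType) (U : finType) (g : U -> T) (s : seq T) :
  injective g -> (forall u, g u \in s) -> #|U| <= size s.
Proof.
move=> g_inj gs; rewrite cardE -(size_map g); apply: uniq_leq_size.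
  by rewrite map_inj_uniq ?enum_uniq.
by move=> x /mapP[u _ ->].
Qed.

(** Each piece is cut into its two ends, which become vertices, and its interior, which becomes a
    path. The last clause says that every piece is a union of blobs. *)
Lemma piece_system_linkage (G : sgraph) (L : seq (G * seq G)) : piece_system L ->
  exists (V U : finType) (e1 e2 : U -> V) (f : V -> G) (Q : U -> seq G),
  [/\ [/\ #|V| <= 2 * size L, #|U| <= size L & forall u, e1 u != e2 u],
      linkage e1 e2 f Q
    & forall s x, s \in L -> x \in piece s ->
        exists2 b, x \in blob f Q b & blob f Q b \subset [set z in piece s]].
Proof.
move=> [cL dL].
pose ends := [seq s.1 | s <- L] ++ [seq last s.1 s.2 | s <- L].
pose V : finType := {x : G | x \in ends}.
(* One-vertex pieces have coinciding ends, so they give a vertex but no path. *)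
pose N := [seq s <- L | ~~ nilp s.2].
pose U : finType := seq_sub N.
have UL (u : U) : val u \in L by have := ssvalP u; rewrite mem_filter => /andP[].
have Un (u : U) : ~~ nilp (val u).2 by have := ssvalP u; rewrite mem_filter => /andP[].
have V1 (u : U) : (val u).1 \in ends by rewrite mem_cat map_f.
have V2 (u : U) : last (val u).1 (val u).2 \in ends by rewrite mem_cat (map_f (fun s => last s.1 s.2)) ?orbT.
pose e1 (u : U) : V := exist (fun x => x \in ends) _ (V1 u).
pose e2 (u : U) : V := exist (fun x => x \in ends) _ (V2 u).
pose f : V -> G := val.
pose Q (u : U) := behead (belast (val u).1 (val u).2).
have uE u : (val u).2 = rcons (Q u) (val (e2 u)) by apply: rcons_interior.
have uC u : chordless (val (e1 u)) (rcons (Q u) (val (e2 u))) by rewrite -uE; apply: cL.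
have uU u : [&& val (e1 u) != val (e2 u), val (e1 u) \notin Q u, val (e2 u) \notin Q u & uniq (Q u)].
  by have := chordless_uniq (uC u); rewrite cons_uniq rcons_uniq mem_rcons in_cons negb_or -andbA.
have Qp u x : x \in Q u -> x \in piece (val u).
  by move=> xu; rewrite /piece uE in_cons mem_rcons in_cons xu !orbT.
exists V, U, e1, e2, f, Q; split.
- split.
  + rewrite (leq_trans (card_le_size val_inj (fun v : V => valP v))) //.
    by rewrite size_cat !size_map addnn mul2n.
  + by rewrite (leq_trans (card_le_size val_inj (fun u : U => UL u))).
  + by move=> u; case/and4P: (uU u).
- split.
  + split.
    * exact: val_inj.
    * by move=> u; case/and4P: (uU u).
    * move=> v u; apply/negP => vu.
      have [s sL [vs vE]] : exists2 s, s \in L &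
          val v \in piece s /\ (val v = s.1 \/ val v = last s.1 s.2).
        have := valP v; rewrite mem_cat => /orP[]/mapP[s sL ->]; exists s => //.
          by split; [rewrite mem_head | left].
        by split; [rewrite mem_last | right].
      (* An end of some piece that lies in the interior of [u] would, by disjointness, be an end of
         [u] itself. *)
      have us := dL _ _ sL (UL u) _ vs (Qp _ _ vu); rewrite us in vE.
      case/and4P: (uU u) => _ n1 n2 _; case: vE => vE; first by move: n1; rewrite /= -vE vu.
      by move: n2; rewrite /= -vE vu.
    * by move=> u u' x /Qp xu /Qp xu'; apply: val_inj; apply: dL xu xu'.
  + by move=> u; have [] := chordless_link (uC u).
  + move=> v u x xu; have [_ _ c1 c2] := chordless_link (uC u).
    by case/orP=> /andP[/eqP->]; [apply: c1 | apply: c2].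
  + by move=> u; have [] := chordless_link (uC u).
move=> s x sL xs.
have endb : x \in ends -> exists2 b, x \in blob f Q b & blob f Q b \subset [set z in piece s].
  by move=> xV; exists (inl (exist (fun x => x \in ends) x xV : V)); rewrite /= ?inE // sub1set inE.
have [n2|n2] := boolP (nilp s.2).
  have xE := xs; rewrite /piece (nilP n2) inE in xE.
  by apply: endb; rewrite (eqP xE) mem_cat map_f.
have sN : s \in N by rewrite mem_filter n2.
pose u : U := SeqSub sN.
have xs' := xs; rewrite /piece (uE u : s.2 = _) in_cons mem_rcons in_cons in xs'.
case/or3P: xs' => [/eqP xE|/eqP xE|xu].
- by apply: endb; rewrite xE mem_cat map_f.
- by apply: endb; rewrite xE; apply: valP.
exists (inr u); first by rewrite /= inE.
by apply/subsetP=> z; rewrite !in_set => /Qp.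
Qed.

Lemma size_flatten_le (T I : eqType) (F : I -> seq T) (s : seq I) m :
  {in s, forall i, size (F i) <= m} -> size (flatten [seq F i | i <- s]) <= size s * m.
Proof.
elim: s => [//|i s IH] Fm /=; rewrite size_cat mulSn leq_add //.
  by apply: Fm; rewrite mem_head.
by apply: IH => j js; apply: Fm; rewrite inE js orbT.
Qed.

(** Each branch set keeps at most [1 + 2 * #|H|] terminals and hence as many pieces, each giving at
    most two vertices and one path; this yields [N]. The equivalence in the conclusion serves minors
    and induced minors alike. *)
Lemma minor_model_linkage (H G : sgraph) (C : H -> {set G}) :
  (forall v, connected_set (C v)) -> (forall v w, v != w -> [disjoint C v & C w]) ->
  let N := 2 * (#|H| * (1 + (#|H| + #|H|))) in
  exists (V U : finType) (e1 e2 : U -> V) (f : V -> G) Q,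
  [/\ [/\ #|V| <= N, #|U| <= N & forall u, e1 u != e2 u], linkage e1 e2 f Q
    & forall (G' : sgraph) (f' : V -> G') Q',
      linkage e1 e2 f' Q' -> similar e1 e2 f Q f' Q' ->
      exists C' : H -> {set G'},
      [/\ forall v, connected_set (C' v), forall v w, v != w -> [disjoint C' v & C' w]
        & forall v w, v != w -> sets_adjacent (C v) (C w) <-> sets_adjacent (C' v) (C' w)]].
Proof.
move=> cC dC N.
have C0 v : exists x, x \in C v by apply/set0Pn; case: (cC v).
have [r rC] := fin_all_exists C0.
(* One contact edge is fixed for every ordered pair of branch sets that have one. *)
pose ct v w := [pick p : G * G | [&& p.1 \in C v, p.2 \in C w & adj G p.1 p.2]].
(* The terminals of [C v] are its ends of the chosen contact edges, in both orders of the pair, and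
   [r v], which keeps the list nonempty. *)
pose T v := r v :: pmap (fun w => omap fst (ct v w)) (enum H) ++
                   pmap (fun w => omap snd (ct w v)) (enum H).
have TC v : {subset T v <= C v}.
  move=> x; rewrite inE mem_cat !mem_pmap => /predU1P[->//|/orP[]/mapP[w _]].
    by rewrite /ct; case: pickP => //= p /and3P[p1 _ _] [->].
  by rewrite /ct; case: pickP => //= p /and3P[_ p2 _] [->].
have sT v : size (T v) <= 1 + (#|H| + #|H|).
  rewrite /= size_cat !size_pmap cardE ltnS.
  by apply: leq_add; apply: count_size.
have [L LP] := fin_all_exists (fun v => connecting_pieces (cC v) (@TC v) isT).
pose LL := flatten [seq L v | v <- enum H].
have LLP s : s \in LL -> exists v, s \in L v by case/flatten_mapP=> v _; exists v.
have LLI v s : s \in L v -> s \in LL.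
  by move=> sv; apply/flatten_mapP; exists v; rewrite ?mem_enum.
have pC v s x : s \in L v -> x \in piece s -> x \in C v.
  by have [_ _ _ LC _] := LP v => sv xs; apply: LC; apply/flatten_mapP; exists s.
have CC v w x : x \in C v -> x \in C w -> v = w.
  move=> xv xw; apply/eqP/negPn/negP => /dC/pred0P/(_ x).
  by rewrite /= xv xw.
have LLsys : piece_system LL.
  split=> [s /LLP[v sv]|s s' /LLP[v sv] /LLP[w sw] x xs xs'].
    by have [_ [c _] _ _ _] := LP v; apply: c.
  have vw := CC _ _ _ (pC _ _ _ sv xs) (pC _ _ _ sw xs'); rewrite -vw in sw.
  by have [_ [_ d] _ _ _] := LP v; apply: d xs xs'.
have [V [U [e1 [e2 [f [Q [[nV nU e12] lk bl]]]]]]] := piece_system_linkage LLsys.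
have sLL : size LL <= #|H| * (1 + (#|H| + #|H|)).
  rewrite [X in _ <= X * _]cardE; apply: size_flatten_le => v _.
  by apply: leq_trans (sT v); have [] := LP v.
exists V, U, e1, e2, f, Q; split=> //; first by split=> //; rewrite /N; lia.
move=> G' f' Q' lk' sim.
pose K v := [set z in pieces (L v)].
have KC v x : x \in K v -> x \in C v by rewrite inE; have [_ _ _ LC _] := LP v; apply: LC.
(* The blobs that make up the shrunken branch set [K v]. An empty blob would belong to every branch
   set and is therefore excluded. *)
pose P v b := (blob f Q b != set0) && (blob f Q b \subset K v).
have KE v : K v = \bigcup_(b | P v b) blob f Q b.
  apply/setP=> x; apply/idP/bigcupP => [|[b /andP[_ /subsetP bK] xb]]; last exact: bK.
  rewrite inE => /flatten_mapP[s sv xs]; have [b xb bs] := bl s x (LLI _ _ sv) xs.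
  exists b => //; apply/andP; split; first by apply/set0Pn; exists x.
  apply: subset_trans bs _; apply/subsetP=> z; rewrite !in_set => zs.
  by apply/flatten_mapP; exists s.
have dfQ : disjoint_family f Q by case: (lk).
have dfQ' : disjoint_family f' Q' by case: (lk').
have Pneq v w b b' : v != w -> P v b -> P w b' -> b != b'.
  move=> vw /andP[/set0Pn[x xb] /subsetP bv] /andP[_ /subsetP bw].
  apply: contraNneq vw => bb'; apply/eqP/(CC _ _ x); apply: KC; [exact: bv|].
  by apply: bw; rewrite -bb'.
have KKE v w : v != w -> sets_adjacent (C v) (C w) <-> sets_adjacent (K v) (K w).
  move=> vw; split=> [[x [y [xv yw xy]]]|[x [y [/KC xv /KC yw xy]]]]; last by exists x, y.
  have : ct v w by rewrite /ct; case: pickP => // /(_ (x, y)); rewrite /= xv yw xy.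
  case Ect: (ct v w) => [[a b]|//] _; exists a, b; split; rewrite ?inE.
  - have [_ _ TL _ _] := LP v; apply: TL; rewrite inE mem_cat; apply/orP; right.
    by apply/orP; left; rewrite mem_pmap; apply/mapP; exists w; rewrite ?mem_enum ?Ect.
  - have [_ _ TL _ _] := LP w; apply: TL; rewrite inE mem_cat; apply/orP; right.
    by apply/orP; right; rewrite mem_pmap; apply/mapP; exists v; rewrite ?mem_enum ?Ect.
  - by move: Ect; rewrite /ct; case: pickP => // p /and3P[_ _ pp] [pE]; move: pp; rewrite pE.
(* The new branch sets are the unions of the corresponding blobs in [G']. *)
exists (fun v => \bigcup_(b | P v b) blob f' Q' b); split.
- move=> v; apply: (@bigcup_connected_transfer _ _ _ _ (blob f Q)).
  + by move=> b b' x; apply: blob_disjoint.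
  + move=> b /andP[b0 _]; apply: (blob_connected lk').
    by rewrite (similar_blob0 lk lk' sim).
  + by move=> b /andP[].
  + by move=> b b' bb'; apply: (proj1 (similar_blob_adjacent sim bb')).
  + by rewrite -KE; have [] := LP v.
- move=> v w vw; apply/pred0P=> x /=; apply/negP => /andP[/bigcupP[b Pb xb] /bigcupP[b' Pb' xb']].
  by have := Pneq _ _ _ _ vw Pb Pb'; rewrite (blob_disjoint dfQ' xb xb') eqxx.
- move=> v w vw; rewrite KKE // !KE; split=> -[x [y [/bigcupP[b Pb xb] /bigcupP[b' Pb' xb'] xy]]].
    have /(proj1 (similar_blob_adjacent sim (Pneq _ _ _ _ vw Pb Pb'))) :
      sets_adjacent (blob f Q b) (blob f Q b') by exists x, y.
    by case=> z [t [zb tb zt]]; exists z, t; split=> //; apply/bigcupP; [exists b | exists b'].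
  have /(proj2 (similar_blob_adjacent sim (Pneq _ _ _ _ vw Pb Pb'))) :
    sets_adjacent (blob f' Q' b) (blob f' Q' b') by exists x, y.
  by case=> z [t [zb tb zt]]; exists z, t; split=> //; apply/bigcupP; [exists b | exists b'].
Qed.

Lemma minor_basis H : has_basis (minor_of H).
Proof.
apply: linkage_basis => G [C [cC dC aC]].
have [V [U [e1 [e2 [f [Q [b lk tr]]]]]]] := minor_model_linkage cC dC.
exists V, U, e1, e2, f, Q; split; [exact: b | exact: lk |].
move=> G' f' Q' lk' /(tr _ _ _ lk')[C' [cC' dC' aC']]; exists C'; split=> // v w vw.
apply/aC'; last exact: aC.
by apply: contraTneq vw => ->; rewrite adj_irr.
Qed.

Lemma induced_minor_basis H : has_basis (induced_minor_of H).
Proof.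
apply: linkage_basis => G [C [cC dC aC]].
have [V [U [e1 [e2 [f [Q [b lk tr]]]]]]] := minor_model_linkage cC dC.
exists V, U, e1, e2, f, Q; split; [exact: b | exact: lk |].
move=> G' f' Q' lk' /(tr _ _ _ lk')[C' [cC' dC' aC']]; exists C'; split=> // v w vw.
by rewrite aC // aC'.
Qed.

Theorem theorem1 :
  (forall H : sgraph,
     exists S1 S2 S3 S4 S5 S6 : seq pathograph,
     forall G : sgraph,
       [/\ (subgraph_of H G <-> contains_some G S1) /\
           (induced_subgraph_of H G <-> contains_some G S2),
           minor_of H G <-> contains_some G S3,
           induced_minor_of H G <-> contains_some G S4,
           topological_minor_of H G <-> contains_some G S5
         & induced_topological_minor_of H G <-> contains_some G S6])
  /\
  (exists Th Py Pr W : seq pathograph,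
     forall G : sgraph,
       [/\ has_induced_theta G <-> contains_some G Th,
           has_induced_pyramid G <-> contains_some G Py,
           has_induced_prism G <-> contains_some G Pr
         & has_induced_wheel G <-> contains_some G W]).
Proof.
split=> [H|].
  have [S1 P1] := subgraph_basis H; have [S2 P2] := induced_subgraph_basis H.
  have [S3 P3] := minor_basis H; have [S4 P4] := induced_minor_basis H.
  have [S5 P5] := topological_minor_basis H.
  have [S6 P6] := induced_topological_minor_basis H.
  by exists S1, S2, S3, S4, S5, S6.
have [Th P7] := theta_basis; have [Py P8] := pyramid_basis.
have [Pr P9] := prism_basis; have [W P10] := wheel_basis.
by exists Th, Py, Pr, W.
Qed.
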